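(* Let $\Sigma$ be a signed graph on $n$ vertices with a linear order on $E(\Sigma)$, and let $L$ be a list-assignment of $\Sigma$. Then $$P(\Sigma,L)=\sum_{i=0}^{n-1}(-1)^i\sum_{F\in\mathcal{C}_i(\Sigma)}\gamma(\langle F\rangle,L)\prod_{j=1}^{n-i}\beta(T_j,L)+\sum_{F\in\mathcal{C}_n(\Sigma)}(-1)^n\gamma(\langle F\rangle,L),$$ where for each $F$, $T_1,\ldots,T_{n-i}$ are all the balanced components of $\langle F\rangle$ (for $F\in\mathcal{C}_i(\Sigma)$ there are exactly $n-i$ of them). In particular, if $L$ is $0$-included, then $$P(\Sigma,L)=\sum_{i=0}^{n-1}(-1)^i\sum_{F\in\mathcal{C}_i(\Sigma)}\prod_{j=1}^{n-i}\beta(T_j,L)+\sum_{F\in\mathcal{C}_n(\Sigma)}(-1)^n,$$ and if $L$ is $0$-free, then $$P(\Sigma,L)=\sum_{i=0}^{n-1}(-1)^i\sum_{F\in\mathcal{C}_i^{*}(\Sigma)}\prod_{j=1}^{n-i}\beta(T_j,L).$$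
   Context: A signed graph $\Sigma=(G,\sigma)$ is a finite graph with $\sigma:E(G)\to\{-1,1\}$; an edge is negative if its sign is $-1$. A cycle is unbalanced if it has an odd number of negative edges, balanced otherwise; a (sub)graph is unbalanced if it contains an unbalanced cycle, balanced otherwise (isolated vertices are balanced components). A list-assignment $L$ assigns to each vertex $v$ a nonempty $L(v)\subseteq\mathbb{Z}$; $L$ is $0$-included if $0\in L(v)$ for all $v$ and $0$-free if $0\notin L(v)$ for all $v$. An $L$-coloring is a map $c$ with $c(v)\in L(v)$ and $c(u)\neq\sigma(e)c(v)$ for every edge $e=uv$; $P(\Sigma,L)$ is the number of $L$-colorings. For $F\subseteq E(\Sigma)$, $\langle F\rangle$ is the spanning subgraph with edge set $F$. For a balanced component $T$, take a partition $V(T)=X_1\cup X_2$ such that the edges of $T$ between $X_1$ and $X_2$ are exactly its negative edges, set $L_1(v)=\{-a:a\in L(v)\}$ for $v\in X_1$ and $L_1(v)=L(v)$ otherwise, and $\beta(T,L)=|\bigcap_{v\in V(T)}L_1(v)|$ (independent of which part is switched). $\gamma(\langle F\rangle,L)=0$ if some vertex $v$ in an unbalanced component of $\langle F\rangle$ has $0\notin L(v)$, and $1$ otherwise. A barbell is the union of two unbalanced cycles $C_1,C_2$ and a (possibly trivial) path $P$ with end vertices $v_1\in V(C_1)$, $v_2\in V(C_2)$ such that $C_1-v_1$ is disjoint from $P\cup C_2$ and $C_2-v_2$ is disjoint from $P\cup C_1$. A circuit is a balanced cycle or a barbell. A broken circuit is the edge set of a circuit with its maximum edge (in the linear order) removed.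 $\mathcal{C}(\Sigma)$ is the family of $F\subseteq E(\Sigma)$ containing no broken circuit; $\mathcal{C}_i(\Sigma)=\{F\in\mathcal{C}(\Sigma):|F|=i\}$ for $i=0,\ldots,n$, and $\mathcal{C}_i^{*}(\Sigma)=\{F\in\mathcal{C}_i(\Sigma):\langle F\rangle\text{ is balanced}\}$ for $i=0,\ldots,n-1$. *)

(* Defs.v *)
From mathcomp Require Import all_boot all_order all_algebra.
From mathcomp Require Import finmap boolp.

Set Implicit Arguments.
Unset Strict Implicit.
Unset Printing Implicit Defensive.

Import Order.TTheory GRing.Theory Num.Theory.

Local Open Scope ring_scope.

(* Loops and parallel edges are allowed. The order of the two endpoints in
   [ends e] carries no meaning: every notion below is symmetric in it. *)
Record signed_graph (V E : finType) := SignedGraph {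
  ends : E -> V * V;
  neg : E -> bool }.

Section SignedGraph.
Variables (V E : finType) (S : signed_graph V E).
Implicit Types (F C D B : {set E}) (T X : {set V}).

Definition sign (e : E) : int := (-1) ^+ neg S e.

Definition joins (e : E) (u v : V) : bool :=
  (ends S e == (u, v)) || (ends S e == (v, u)).

Definition vertices F : {set V} :=
  [set v | [exists e in F, (v == (ends S e).1) || (v == (ends S e).2)]].

(* A walk from [x] is the sequence of its successive (edge, next vertex)
   steps. *)
Fixpoint walk (x : V) (p : seq (E * V)) : bool :=
  if p is (e, y) :: p' then joins e x y && walk y p' else true.

Definition is_path (x y : V) (p : seq (E * V)) : bool :=
  [&& walk x p, last x (unzip2 p) == y & uniq (x :: unzip2 p)].

(* Cycles are identified with their edge sets. A loop is a cycle of length 1;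
   requiring distinct edges only matters for length 2, where it asks for two
   parallel edges. *)
Definition is_cycle C : Prop :=
  exists x p, [/\ p <> [::], walk x p, last x (unzip2 p) = x,
                  uniq (unzip2 p) && uniq (unzip1 p)
                & C = [set e in unzip1 p]].

Definition unbalanced_cycle C : Prop :=
  is_cycle C /\ odd #|[set e in C | neg S e]|.

Definition balanced_cycle C : Prop :=
  is_cycle C /\ ~~ odd #|[set e in C | neg S e]|.

Definition balanced F : bool :=
  `[< ~ exists2 C : {set E}, C \subset F & unbalanced_cycle C >].

(* Components of the spanning subgraph <F>, given by their vertex sets; the
   edge set of the component [T] is [component_edges F T]. *)
Definition adjacent F : rel V := [rel u v | [exists e in F, joins e u v]].

Definition components F : {set {set V}} :=
  [set [set v | connect (adjacent F) u v] | u : V].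

Definition component_edges F T : {set E} :=
  [set e in F | ((ends S e).1 \in T) && ((ends S e).2 \in T)].

Definition balanced_component F T : bool := balanced (component_edges F T).

Definition balanced_components F : {set {set V}} :=
  [set T in components F | balanced_component F T].

(* [C1 != C2] is only needed to prevent a single unbalanced loop from being
   used as both cycles. *)
Definition is_barbell D : Prop :=
  exists C1 C2 v1 v2 p,
    [/\ [/\ unbalanced_cycle C1, unbalanced_cycle C2 & C1 != C2],
        [/\ is_path v1 v2 p, v1 \in vertices C1 & v2 \in vertices C2],
        [disjoint vertices C1 :\ v1 & [set v in v1 :: unzip2 p] :|: vertices C2],
        [disjoint vertices C2 :\ v2 & [set v in v1 :: unzip2 p] :|: vertices C1]
      & D = C1 :|: C2 :|: [set e in unzip1 p]].

Definition is_circuit C : Prop := balanced_cycle C \/ is_barbell C.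

Definition is_broken_circuit (le : rel E) B : Prop :=
  exists C m, [/\ is_circuit C, m \in C, (forall e, e \in C -> le e m)
                & B = C :\ m].

Definition nbc (le : rel E) : {set {set E}} :=
  [set F : {set E} | `[< ~ exists2 B : {set E}, is_broken_circuit le B & B \subset F >]].

Definition nbc_card (le : rel E) (i : nat) : {set {set E}} :=
  [set F in nbc le | #|F| == i].

Definition nbc_card_bal (le : rel E) (i : nat) : {set {set E}} :=
  [set F in nbc_card le i | balanced F].

Variable L : V -> {fset int}.

Definition zero_included : Prop := forall v, 0 \in L v.

Definition zero_free : Prop := forall v, 0 \notin L v.

(* The type of [c] enforces c(v) \in L v. *)
Definition num_colorings : nat :=
  #|[set c : {dffun forall v : V, L v} |
      [forall e : E, val (c (ends S e).1) != sign e * val (c (ends S e).2)]]|.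

(* The two parts are [X] and [T :\: X]; [X] is the part that is switched. *)
Definition is_switching F T X : bool :=
  (X \subset T) &&
  [forall e in component_edges F T,
     neg S e == (((ends S e).1 \in X) (+) ((ends S e).2 \in X))].

Definition switched_list X (v : V) : {fset int} :=
  if v \in X then [fset - a | a in L v]%fset else L v.

(* [T] is never empty, so restricting to the union loses nothing in the
   intersection of the switched lists. The value 0 is not reached on balanced
   components, which always have a switching. *)
Definition beta F T : nat :=
  if [pick X | is_switching F T X] is Some X then
    #|` [fset a in (\bigcup_(v in T) switched_list X v)%fset
          | [forall v in T, a \in switched_list X v]]%fset|
  else 0%N.

Definition gamma F : nat :=
  if [exists T in components F,
        ~~ balanced_component F T && [exists v in T, 0 \notin L v]]
  then 0%N else 1%N.

End SignedGraph.

(* Main.v *)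
(** Fix a coloring c and let A be the set of the edges e = uv that c violates,
    i.e. with c(u) = sigma(e) c(v). Whenever all edges of a circuit but one lie
    in A, so does the last one; hence, when A is nonempty, toggling the maximum
    edge of A is a sign-reversing involution on the members of C(Sigma) inside
    A. Summing over c gives P = sum_F (-1)^|F| N(F) over F in C(Sigma), where
    N(F) counts the colorings violating every edge of F. On a balanced
    component such a coloring is a constant up to switching, and on an
    unbalanced one it is 0, so N(F) = gamma(F) prod_j beta(T_j).

    For the number of balanced components, the lists {-1, 0, 1} identify N(F)
    with the number 3^b(F) of solutions over F_3 of the linear system attached
    to F. Adding an edge e = uv divides this number by at most 3, and the number
    only stays the same if e follows from F. In that case F + e contains a
    circuit: either a balanced cycle through e, or u and v both lie in
    unbalanced components. The unbalanced cycles then yield a barbell, except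
    when an F-path from v to u meets an unbalanced cycle in two vertices; but
    then it can be rerouted along either arc of that cycle, and one choice of
    arc closes a balanced cycle with e. *)

Require Import Defs.
From mathcomp Require Import all_boot all_order all_algebra.
From mathcomp Require Import finmap boolp.

Set Implicit Arguments.
Unset Strict Implicit.
Unset Printing Implicit Defensive.

Import Order.TTheory GRing.Theory Num.Theory.

Local Open Scope ring_scope.

(** * Walks and cycles *)

Section Walks.
Variables (V E : finType) (S : signed_graph V E).
Implicit Types (F C D : {set E}) (p q : seq (E * V)) (x y z u v w : V).

Local Notation walk := (walk S).
Local Notation joins := (joins S).
Local Notation is_path := (is_path S).
Local Notation vertices := (vertices S).

Definition walk_end x p := last x (unzip2 p).
Arguments walk_end : simpl never.

(** Signs of walks are kept as booleans, so that concatenation becomes [(+)]; the sign itself is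
    [(-1) ^+ walk_neg p]. *)
Definition walk_neg p := odd (count (neg S) (unzip1 p)).

Fixpoint rev_walk x p :=
  if p is (e, y) :: p' then rcons (rev_walk y p') (e, x) else [::].

Lemma joinsC e x y : joins e x y = joins e y x.
Proof. by rewrite /Defs.joins orbC. Qed.

Lemma joins_ends e : joins e (ends S e).1 (ends S e).2.
Proof. by rewrite /Defs.joins -surjective_pairing eqxx. Qed.

Lemma joins_pair e x y x' y' : joins e x y -> joins e x' y' ->
  (x = x' /\ y = y') \/ (x = y' /\ y = x').
Proof.
rewrite /Defs.joins; case/orP=> /eqP->; case/orP; rewrite xpair_eqE;
  by case/andP=> /eqP-> /eqP->; auto.
Qed.

Lemma unzip1_cat p q : unzip1 (p ++ q) = unzip1 p ++ unzip1 q.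
Proof. exact: map_cat. Qed.

Lemma unzip2_cat p q : unzip2 (p ++ q) = unzip2 p ++ unzip2 q.
Proof. exact: map_cat. Qed.

Lemma walk_end_cat x p q : walk_end x (p ++ q) = walk_end (walk_end x p) q.
Proof. by rewrite /walk_end unzip2_cat last_cat. Qed.

Lemma walk_end_cons x e y p : walk_end x ((e, y) :: p) = walk_end y p.
Proof. by []. Qed.

Lemma walk_cat x p q : walk x (p ++ q) = walk x p && walk (walk_end x p) q.
Proof. by elim: p x => [|[e y] p IHp] x //=; rewrite IHp andbA. Qed.

Lemma walk_neg_cat p q : walk_neg (p ++ q) = walk_neg p (+) walk_neg q.
Proof. by rewrite /walk_neg unzip1_cat count_cat oddD. Qed.

Lemma walk_neg_cons e y p : walk_neg ((e, y) :: p) = neg S e (+) walk_neg p.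
Proof. by rewrite /walk_neg /= oddD oddb. Qed.

Lemma walk_end_mem x p : walk_end x p \in x :: unzip2 p.
Proof. exact: mem_last. Qed.

Lemma unzip1_rev_walk x p : unzip1 (rev_walk x p) = rev (unzip1 p).
Proof.
elim: p x => [|[e y] p IHp] x //=.
by rewrite /unzip1 map_rcons -/unzip1 IHp rev_cons.
Qed.

Lemma walk_neg_rev x p : walk_neg (rev_walk x p) = walk_neg p.
Proof. by rewrite /walk_neg unzip1_rev_walk count_rev. Qed.

Lemma unzip2_rev_walk x p :
  walk_end x p :: unzip2 (rev_walk x p) = rev (x :: unzip2 p).
Proof.
elim: p x => [|[e y] p IHp] x //=.
rewrite /unzip2 map_rcons -/unzip2 /= rev_cons -IHp.
by rewrite -rcons_cons.
Qed.

Lemma walk_end_rev x p : walk_end (walk_end x p) (rev_walk x p) = x.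
Proof.
case: p => [|[e y] p] //=.
by rewrite /walk_end /unzip2 map_rcons last_rcons.
Qed.

Lemma walk_rev x p : walk x p -> walk (walk_end x p) (rev_walk x p).
Proof.
elim: p x => [|[e y] p IHp] x //= /andP[jxy /IHp wp].
rewrite -cats1 walk_cat walk_end_cons wp /=.
by rewrite walk_end_rev joinsC jxy.
Qed.

Lemma is_path_rev x y p : is_path x y p -> is_path y x (rev_walk x p).
Proof.
case/and3P=> wp /eqP ep up; rewrite -/(walk_end x p) in ep; rewrite -ep.
apply/and3P; split; first exact: walk_rev.
  by rewrite -/(walk_end _ _) walk_end_rev.
by rewrite unzip2_rev_walk rev_uniq.
Qed.

Lemma is_path_cat x y p q : is_path x y (p ++ q) ->
  is_path x (walk_end x p) p /\ is_path (walk_end x p) y q.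
Proof.
case/and3P; rewrite walk_cat -/(walk_end _ _) walk_end_cat => /andP[wp wq] eq.
rewrite unzip2_cat -cat_cons cat_uniq => /and3P[up disj uq].
split; apply/and3P; split=> //.
rewrite /= uq andbT; apply: contra disj => inq.
by apply/hasP; exists (walk_end x p) => //; apply: walk_end_mem.
Qed.

Lemma edge_split e p : e \in unzip1 p -> exists p1 y p2, p = p1 ++ (e, y) :: p2.
Proof.
case/mapP=> -[e' y] /path.splitPr[p1 p2] /= ->.
by exists p1, y, p2.
Qed.

Lemma vertex_split y p : y \in unzip2 p -> exists p1 e p2, p = p1 ++ (e, y) :: p2.
Proof.
case/mapP=> -[e y'] /path.splitPr[p1 p2] /= ->.
by exists p1, e, p2.
Qed.

Lemma walk_split x y p : y \in x :: unzip2 p ->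
  exists p1 p2, p = p1 ++ p2 /\ walk_end x p1 = y.
Proof.
rewrite inE => /predU1P[->|/vertex_split[p1 [e [p2 ->]]]].
  by exists [::], p.
exists (rcons p1 (e, y)), p2; rewrite cat_rcons; split=> //.
by rewrite /walk_end /unzip2 map_rcons last_rcons.
Qed.

Lemma not_path_loop x p : ~~ uniq (x :: unzip2 p) ->
  exists p1 p2 p3, [/\ p = p1 ++ p2 ++ p3, p2 != [::]
                     & walk_end (walk_end x p1) p2 = walk_end x p1].
Proof.
elim: p x => [|[e y] p IHp] x //=.
rewrite negb_and negbK; case: (boolP (x \in _)) => [xin _|_ /= /IHp].
  have [p1 [p2 [-> ex]]] := walk_split xin.
  by exists [::], ((e, y) :: p1), p2; split.
case=> p1 [p2 [p3 [-> n2 e2]]].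
by exists ((e, y) :: p1), p2, p3.
Qed.

Lemma first_hit (A : pred V) x p : has A (x :: unzip2 p) ->
  exists p1 p2, [/\ p = p1 ++ p2, A (walk_end x p1)
    & forall z, z \in x :: unzip2 p1 -> A z -> z = walk_end x p1].
Proof.
elim: p x => [|[e y] p IHp] x.
  rewrite /= orbF => Ax; exists [::], [::]; split=> // z.
  by rewrite inE => /eqP.
rewrite [has _ _]/(A x || has A (y :: unzip2 p)).
case: (boolP (A x)) => [Ax _|nAx /= /IHp].
  by exists [::], ((e, y) :: p); split=> // z; rewrite inE => /eqP.
case=> p1 [p2 [-> Ae H]]; exists ((e, y) :: p1), p2; split=> // z.
rewrite inE => /predU1P[-> /(negP nAx)//|]; exact: H.
Qed.

Lemma last_hit (A : pred V) x p : has A (x :: unzip2 p) ->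
  exists p1 p2, [/\ p = p1 ++ p2, A (walk_end x p1)
    & forall z, z \in unzip2 p2 -> ~~ A z].
Proof.
elim: p x => [|[e y] p IHp] x.
  by rewrite /= orbF => Ax; exists [::], [::].
rewrite [has _ _]/(A x || has A (y :: unzip2 p)).
case: (boolP (has A (y :: unzip2 p))) => [/IHp|/hasPn H].
  case=> p1 [p2 [-> Ae H]] _; by exists ((e, y) :: p1), p2.
move=> /orP[Ax|//]; exists [::], ((e, y) :: p); split=> // z; exact: H.
Qed.

Lemma walk_edge_mem x p e : walk x p -> e \in unzip1 p ->
  ((ends S e).1 \in x :: unzip2 p) && ((ends S e).2 \in x :: unzip2 p).
Proof.
move=> wp /edge_split[p1 [y [p2 def_p]]]; move: wp; rewrite {}def_p.
rewrite walk_cat unzip2_cat => /andP[_ /= /andP[j _]].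
have inl : walk_end x p1 \in x :: unzip2 p1 ++ y :: unzip2 p2.
  by rewrite -cat_cons mem_cat walk_end_mem.
have inr : y \in x :: unzip2 p1 ++ y :: unzip2 p2.
  by rewrite -cat_cons mem_cat mem_head orbT.
by have [[-> ->]|[-> ->]] := joins_pair (joins_ends e) j; rewrite ?inl ?inr.
Qed.

Lemma vertices_edge F e x y : e \in F -> joins e x y ->
  (x \in vertices F) && (y \in vertices F).
Proof.
move=> eF j; rewrite !inE; apply/andP; split; apply/existsP; exists e; rewrite eF /=;
by have [[-> ->]|[-> ->]] := joins_pair (joins_ends e) j; rewrite !eqxx ?orbT.
Qed.

Lemma verticesP F z :
  reflect (exists e, e \in F /\ (z = (ends S e).1 \/ z = (ends S e).2))
          (z \in vertices F).
Proof.
rewrite inE; apply: (iffP existsP) => [[e /andP[eF /orP[]/eqP->]]|[e [eF]]].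
- by exists e; split=> //; left.
- by exists e; split=> //; right.
- by move=> ze; exists e; rewrite eF; apply/orP; case: ze => ->; [left|right].
Qed.

(** A later use of the first edge would revisit the starting vertex. *)
Lemma path_uniq_edges x y p : is_path x y p -> uniq (unzip1 p).
Proof.
case/and3P=> wp _; elim: p x wp => [|[e z] p IHp] x //= /andP[j wp].
case/andP=> xn up; rewrite (IHp _ wp up) andbT.
apply: contra xn => /(walk_edge_mem wp)/andP[].
by have [[-> ->]|[-> ->]] := joins_pair (joins_ends e) j.
Qed.

Lemma path_no_loop x y p e z : is_path x y p -> e \in unzip1 p -> ~~ joins e z z.
Proof.
move=> pp /edge_split[p1 [w [p2 def_p]]]; apply/negP => jz.
move: pp; rewrite {}def_p => /is_path_cat[_ /and3P[/= /andP[j _] _]].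
by have [[-> ->]|[-> ->]] := joins_pair j jz; rewrite inE eqxx.
Qed.

Lemma path_closed x p : is_path x x p -> p = [::].
Proof.
case: p => [|[e y] p] //= /and3P[_ /eqP /= <-].
by rewrite /= mem_last.
Qed.

(** * Cycles and their arcs *)

Section Cycles.
Variable C : {set E}.

Lemma vertices_path m u v q : joins m u v -> is_path v u q ->
  vertices (m |: [set e in unzip1 q]) = [set w in v :: unzip2 q].
Proof.
move=> j /and3P[wq /eqP eq _]; apply/setP=> z; rewrite [in RHS]inE.
have uin : u \in v :: unzip2 q by rewrite -eq mem_last.
apply/idP/idP => [/verticesP[e [+ ze]]|].
  rewrite !inE => /predU1P[em|/(walk_edge_mem wq)/andP[]]; last by case: ze => ->.
  rewrite em {em e} in ze.
  have [[e1 e2]|[e1 e2]] := joins_pair (joins_ends m) j;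
    by rewrite e1 e2 in ze; case: ze => ->; rewrite -in_cons ?mem_head.
rewrite inE => /predU1P[->|/vertex_split[p1 [e [p2 def_q]]]].
  by have /andP[] := vertices_edge (setU11 m [set e in unzip1 q]) j.
move: (wq); rewrite {1}def_q walk_cat /= => /and3P[_ je _].
have eF : e \in m |: [set e in unzip1 q].
  by rewrite !inE def_q unzip1_cat mem_cat mem_head !orbT.
by have /andP[] := vertices_edge eF je.
Qed.

Lemma cycle_of_path m u v q : joins m u v -> is_path v u q ->
  m \notin unzip1 q -> is_cycle S (m |: [set e in unzip1 q]).
Proof.
move=> j pq nm; have uq := path_uniq_edges pq.
case/and3P: pq => wq /eqP eq uv.
exists u, ((m, v) :: q); split=> //=; first by rewrite j.
  by rewrite nm uq !andbT.
by apply/setP=> e; rewrite !inE.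
Qed.

(* A cycle is an edge closing up a path that avoids it. *)
Definition cycle_decomposition m u v q :=
  [/\ joins m u v, is_path v u q, m \notin unzip1 q & C = m |: [set e in unzip1 q]].

(** Rotate the closed walk so that it begins with the step [(m, v)]. *)
Lemma cycle_rot x p1 m v p2 : let p := p1 ++ (m, v) :: p2 in
  walk x p -> walk_end x p = x -> uniq (unzip2 p) -> uniq (unzip1 p) ->
  C = [set e in unzip1 p] ->
  cycle_decomposition m (walk_end x p1) v (p2 ++ p1).
Proof.
move=> p; rewrite {}/p walk_cat walk_end_cat.
rewrite walk_end_cons => /= /and3P[w1 j w2] ex uv ue defC.
split=> //.
- apply/and3P; split; first by rewrite walk_cat w2 ex w1.
    by rewrite -/(walk_end _ _) walk_end_cat ex.
  by rewrite unzip2_cat -cat_cons uniq_catC -(unzip2_cat p1 ((m,v) :: p2)).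
- move: ue; rewrite unzip1_cat uniq_catC /= unzip1_cat.
  by case/andP.
- apply/setP=> e; rewrite defC !inE !unzip1_cat !mem_cat /= inE.
  by case: (e == m); rewrite ?orbT //= orbC.
Qed.

Lemma cycle_edge m : is_cycle S C -> m \in C ->
  exists u v q, cycle_decomposition m u v q.
Proof.
case=> x [p [_ wp ep /andP[uv ue] defC]]; rewrite defC inE => /edge_split.
case=> p1 [v [p2 def_p]]; exists (walk_end x p1), v, (p2 ++ p1).
by apply: cycle_rot; rewrite -def_p.
Qed.

Lemma cycle_vertex a : is_cycle S C -> a \in vertices C ->
  exists m u q, cycle_decomposition m u a q.
Proof.
move=> cC aC; case: cC => x [p [_ wp ep /andP[uv ue] defC]].
have /vertex_split[p1 [m [p2 def_p]]] : a \in unzip2 p.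
  move: aC => /verticesP[f [fC af]].
  have fp : f \in unzip1 p by rewrite defC inE in fC.
  have {af} : a \in x :: unzip2 p.
    by have /andP[] := walk_edge_mem wp fp; case: af => ->.
  rewrite inE => /predU1P[->|//]; rewrite -ep.
  by case: p fp {wp ep uv ue defC} => [//|[? ?] ?] _ /=; exact: mem_last.
exists m, (walk_end x p1), (p2 ++ p1).
by apply: cycle_rot; rewrite -def_p.
Qed.

Lemma odd_neg_cycle m u v q : cycle_decomposition m u v q ->
  odd #|[set e in C | neg S e]| = neg S m (+) walk_neg q.
Proof.
case=> _ /path_uniq_edges uq nm defC.
have -> : #|[set e in C | neg S e]| = count (neg S) (m :: unzip1 q).
  rewrite -size_filter -(card_uniqP _); last by rewrite filter_uniq //= nm.
  apply: eq_card => e; rewrite defC [LHS]inE mem_filter andbC; congr (_ && _).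
  by rewrite !inE.
by rewrite /= oddD oddb.
Qed.

(** Start the cycle at [a]: one arc is the part of the path up to [w], the other takes the closing
    edge [m] backwards and returns to [w] along the reversed rest. Together they use every edge
    once, so on an odd cycle their signs differ. *)
Lemma cycle_arcs a w : unbalanced_cycle S C ->
  a \in vertices C -> w \in vertices C -> a != w ->
  exists p q, [/\ is_path a w p, is_path a w q, walk_neg p != walk_neg q,
     {subset unzip1 p ++ unzip1 q <= C}
   & {subset unzip2 p ++ unzip2 q <= vertices C}].
Proof.
case=> cC oC aC wC naw.
have [m [u [q dC]]] := cycle_vertex cC aC.
have := odd_neg_cycle dC; rewrite {}oC => /esym odd_q.
case: dC => j pq nm defC.
have vC : vertices C = [set w in a :: unzip2 q] by rewrite defC (vertices_path j pq).
have uC : u \in vertices C.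
  have mC : m \in C by rewrite defC setU11.
  by have /andP[] := vertices_edge mC j.
have := wC; rewrite [in X in X -> _]vC inE => /walk_split[q1 [q2 [def_q ew]]].
have [p1 p2] : is_path a w q1 /\ is_path w u q2.
  by rewrite -ew; apply: is_path_cat; rewrite -def_q.
have p2r := is_path_rev p2.
have e2 : walk_end w q2 = u by case/and3P: p2 => _ /eqP.
have def2 : u :: unzip2 (rev_walk w q2) = rev (w :: unzip2 q2).
  by rewrite -unzip2_rev_walk e2.
have a2 : a \notin w :: unzip2 q2.
  rewrite inE (negPf naw) /=; case/and3P: pq => _ _ /=.
  by rewrite def_q unzip2_cat mem_cat negb_or => /andP[/andP[]].
exists q1, ((m, u) :: rev_walk w q2); split=> //.
- case/and3P: p2r => w2 e2' u2; apply/and3P; split=> //=.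
    by rewrite joinsC j.
  by apply/andP; split=> //; rewrite def2 mem_rev.
- move: odd_q; rewrite def_q walk_neg_cat walk_neg_cons walk_neg_rev.
  by case: (neg S m); case: (walk_neg q1); case: (walk_neg q2).
- move=> e; rewrite mem_cat /= inE unzip1_rev_walk mem_rev defC !inE def_q.
  by rewrite unzip1_cat mem_cat orbCA.
- move=> z; rewrite mem_cat => /orP[z1|].
    by rewrite vC !inE def_q unzip2_cat mem_cat z1 orbT.
  rewrite [unzip2 _]def2 mem_rev inE => /predU1P[->//|z2].
  by rewrite vC !inE def_q unzip2_cat mem_cat z2 !orbT.
Qed.

End Cycles.

(* A repeated vertex splits the walk into two shorter closed walks, one of which
   is odd. *)
Lemma closed_odd_walk F x p : walk x p -> walk_end x p = x -> walk_neg p ->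
  {subset unzip1 p <= F} -> exists2 C : {set E}, C \subset F & unbalanced_cycle S C.
Proof.
have [n] := ubnP (size p); elim: n => // n IHn in x p *.
case: p => [|[e y] p] //; rewrite ltnS => /= sz /andP[j wp].
rewrite walk_end_cons => ep np pF.
have [up|/not_path_loop[p1 [p2 [p3 [def_p n2 e2]]]]] := boolP (uniq (y :: unzip2 p)).
  have pp : is_path y x p by apply/and3P; split=> //; apply/eqP.
  (* Here the rest [p] is a path. If it uses [e], it does so at once, since it starts at [y], and
     then stops, since it has reached [x]; the walk is [e] there and back, which is even. *)
  have [ein|nein] := boolP (e \in unzip1 p).
    have [p1 [z [p2 def_p]]] := edge_split ein.
    move: pp np; rewrite {}def_p {ein wp ep pF sz up} => pp.
    have [pp1 /and3P[/= /andP[j' w2] ez uz]] := is_path_cat pp.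
    have zy : z != y.
      apply: contraTneq pp => ->; rewrite /Defs.is_path /= unzip2_cat.
      by rewrite mem_cat mem_head orbT !andbF.
    have [[_ ezy]|[e1 ezx]] := joins_pair j' j; first by rewrite ezy eqxx in zy.
    move: pp1; rewrite e1 => /path_closed->.
    have -> : p2 = [::].
      apply: (@path_closed z); apply/and3P; split=> //; first by rewrite [X in _ == X]ezx.
      by case/andP: uz.
    by rewrite /walk_neg /= addn0 addnn odd_double.
  have cd : cycle_decomposition (e |: [set e in unzip1 p]) e x y p by split.
  exists (e |: [set e in unzip1 p]).
    apply/subsetP=> f; rewrite !inE => fp; exact: pF.
  split; first exact: cycle_of_path j pp nein.
  by rewrite (odd_neg_cycle cd) -(walk_neg_cons e y).
move: wp; rewrite def_p !walk_cat => /and3P[w1 w2 w3].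
have s2 : (0 < size p2)%N by case: (p2) n2.
have sub q : {subset q <= (e, y) :: p} -> {subset unzip1 q <= F}.
  by move=> qp f /mapP[g gq ->]; apply: pF; apply: (map_f fst (qp g gq)).
rewrite def_p !size_cat in sz.
case n2': (walk_neg p2).
  apply: (IHn _ p2) e2 n2' _ => //.
    by apply: leq_trans sz; rewrite addnCA leq_addr.
  by apply: sub => f fp; rewrite inE def_p !mem_cat fp !orbT.
apply: (IHn x ((e, y) :: p1 ++ p3)) => /=.
- by apply: leq_trans sz; rewrite ltnS size_cat -addnS leq_add2l -add1n leq_add2r.
- by rewrite j walk_cat w1 -e2 w3.
- rewrite walk_end_cons walk_end_cat -e2.
  by rewrite -!walk_end_cat -def_p.
- by move: np; rewrite def_p !walk_neg_cons !walk_neg_cat n2'.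
- apply: (sub ((e, y) :: p1 ++ p3)) => f; rewrite !inE def_p !mem_cat.
  by case/or3P=> ->; rewrite ?orbT.
Qed.

End Walks.

(** * Connectivity and balance *)

Section Connectivity.
Variables (V E : finType) (S : signed_graph V E).
Implicit Types (F G C D : {set E}) (A B : {set V}) (p q : seq (E * V)).
Implicit Types (x y z u v w : V).

Local Notation walk := (walk S).
Local Notation joins := (joins S).
Local Notation is_path := (is_path S).
Local Notation vertices := (vertices S).
Local Notation conn F := (connect (adjacent S F)).

Lemma adjacentP F x y :
  reflect (exists2 e, e \in F & joins e x y) (adjacent S F x y).
Proof. exact: exists_inP. Qed.

Lemma connC F : connect_sym (adjacent S F).
Proof.
apply: sym_connect_sym => x y; apply/adjacentP/adjacentP => -[e eF j];
  by exists e; rewrite // joinsC.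
Qed.

Lemma conn_edge F e x y : e \in F -> joins e x y -> conn F x y.
Proof. by move=> eF j; apply: connect1; apply/adjacentP; exists e. Qed.

Lemma walk_conn F x p z : walk x p -> {subset unzip1 p <= F} ->
  z \in x :: unzip2 p -> conn F x z.
Proof.
elim: p x => [|[e y] p IHp] x /=.
  by move=> _ _; rewrite inE => /eqP->.
case/andP=> j wp pF; rewrite inE => /predU1P[->//|zin].
apply: connect_trans (IHp y wp _ zin).
  by apply: conn_edge j; apply: pF; rewrite mem_head.
by move=> f fp; apply: pF; rewrite inE fp orbT.
Qed.

Lemma conn_path F x y : conn F x y ->
  exists2 p, is_path x y p & {subset unzip1 p <= F}.
Proof.
case/connectP=> s0 /shortenP[s ps us _] ->.
have [p [wp pF def_s]] : exists p, [/\ walk x p, {subset unzip1 p <= F} & unzip2 p = s].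
  elim: s x ps {us} => [|z s IHs] x /=; first by exists [::].
  case/andP=> /adjacentP[e eF j] /IHs[p [wp pF <-]].
  exists ((e, z) :: p); split=> //=; first by rewrite j.
  by move=> f; rewrite inE => /predU1P[->|/pF].
by exists p => //; apply/and3P; rewrite def_s.
Qed.

Lemma conn_sub F G x y : F \subset G -> conn F x y -> conn G x y.
Proof.
move=> /subsetP FG; apply: connect_sub => u v /adjacentP[e /FG eG j].
exact: conn_edge eG j.
Qed.

Lemma cycle_conn F C x y : is_cycle S C -> C \subset F ->
  x \in vertices C -> y \in vertices C -> conn F x y.
Proof.
move=> cC /subsetP CF xC; have [m [u [q [j pq nm defC]]]] := cycle_vertex cC xC.
rewrite defC (vertices_path j pq) inE; case/and3P: pq => wq _ _.
apply: walk_conn wq _ => f fq; apply: CF; rewrite defC !inE fq orbT //.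
Qed.

(** Cut a path at its last vertex in [A], then cut the remainder at its first vertex in [B]. *)
Lemma linking_path F A B x y : x \in A -> y \in B -> conn F x y ->
  exists a b p, [/\ is_path a b p, {subset unzip1 p <= F}, a \in A, b \in B
    & forall z, z \in a :: unzip2 p -> (z \in A -> z = a) /\ (z \in B -> z = b)].
Proof.
move=> xA yB /conn_path[p pp pF].
have ep : walk_end x p = y by case/and3P: pp => _ /eqP.
have hA : has (mem A) (x :: unzip2 p) by apply/hasP; exists x; rewrite ?mem_head.
have [p1 [p2 [def_p aA nA]]] := last_hit hA.
set a := walk_end x p1 in aA; have [_ pp2] : is_path x a p1 /\ is_path a y p2.
  by apply: is_path_cat; rewrite -def_p.
have ep2 : walk_end a p2 = y by case/and3P: pp2 => _ /eqP.
have hB : has (mem B) (a :: unzip2 p2).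
  by apply/hasP; exists y => //; rewrite -ep2 walk_end_mem.
have [p3 [p4 [def_p2 bB uB]]] := first_hit hB.
set b := walk_end a p3 in bB uB; have [pp3 _] : is_path a b p3 /\ is_path b y p4.
  by apply: is_path_cat; rewrite -def_p2.
exists a, b, p3; split=> //.
  by move=> e ep3; apply: pF; rewrite def_p def_p2 !unzip1_cat !mem_cat ep3 !orbT.
move=> z zin; split=> [zA|zB]; last exact: uB.
move: zin; rewrite inE => /predU1P[//|zp3]; suff: z \notin A by rewrite zA.
by apply: nA; rewrite def_p2 unzip2_cat mem_cat zp3.
Qed.

(** If the cycles share a vertex, it is the only one and serves as a trivial path. Otherwise a
    linking path that meets each cycle only at its end joins them. *)
Lemma barbell_exists F C1 C2 x y :
  unbalanced_cycle S C1 -> unbalanced_cycle S C2 -> C1 != C2 ->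
  C1 \subset F -> C2 \subset F ->
  {in vertices C1 :&: vertices C2 &, forall u v, u = v} ->
  x \in vertices C1 -> y \in vertices C2 -> conn F x y ->
  exists2 D : {set E}, D \subset F & is_barbell S D.
Proof.
move=> u1 u2 n12 C1F C2F le1 xC1 yC2 xy.
have [[a a12]|disj] := pselect (exists a, a \in vertices C1 :&: vertices C2).
  have [aC1 aC2] := setIP a12.
  exists (C1 :|: C2); first by rewrite subUset C1F.
  exists C1, C2, a, a, [::]; split=> //.
  - by split=> //; apply/and3P; split=> //=.
  - rewrite disjoint_subset; apply/subsetP=> z; rewrite in_setD1 => /andP[za zC1].
    rewrite inE in_setU negb_or inE mem_seq1 za /=.
    by apply: contra za => zC2; apply/eqP/le1 => //; apply/setIP.
  - rewrite disjoint_subset; apply/subsetP=> z; rewrite in_setD1 => /andP[za zC2].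
    rewrite inE in_setU negb_or inE mem_seq1 za /=.
    by apply: contra za => zC1; apply/eqP/le1 => //; apply/setIP.
  - by apply/setP=> e; rewrite !inE orbF.
have [v1 [v2 [p [pp pF v1C v2C vp]]]] := linking_path xC1 yC2 xy.
have ndisj z : z \in vertices C1 -> z \in vertices C2 -> False.
  by move=> z1 z2; apply: disj; exists z; apply/setIP.
exists (C1 :|: C2 :|: [set e in unzip1 p]).
  rewrite !subUset C1F C2F; apply/subsetP=> e; rewrite inE; exact: pF.
exists C1, C2, v1, v2, p; split=> //.
- rewrite disjoint_subset; apply/subsetP=> z; rewrite in_setD1 => /andP[za zC1].
  rewrite inE in_setU negb_or inE; apply/andP; split.
    by apply: contra za => /vp[/(_ zC1)/eqP].
  by apply/negP => /(ndisj _ zC1).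
- rewrite disjoint_subset; apply/subsetP=> z; rewrite in_setD1 => /andP[za zC2].
  rewrite inE in_setU negb_or inE; apply/andP; split.
    by apply: contra za => /vp[_ /(_ zC2)/eqP].
  by apply/negP => /ndisj/(_ zC2).
Qed.

Lemma componentP F T x : T \in components S F -> x \in T ->
  T = [set v | conn F x v].
Proof.
case/imsetP=> u _ -> ; rewrite inE => ux; apply/setP=> z.
by rewrite !inE (same_connect (@connC F) ux).
Qed.

Lemma component_in F x : [set v | conn F x v] \in components S F.
Proof. exact: imset_f. Qed.

Lemma component_edgesS F T : component_edges S F T \subset F.
Proof. by apply/subsetP=> e; rewrite inE => /andP[]. Qed.

Lemma walk_component_edges F x p : walk x p -> {subset unzip1 p <= F} ->
  {subset unzip1 p <= component_edges S F [set v | conn F x v]}.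
Proof.
move=> wp pF e ep; rewrite !inE pF //=.
by have /andP[/(walk_conn wp pF)-> /(walk_conn wp pF)->] := walk_edge_mem wp ep.
Qed.

Lemma unbalanced_componentP F x :
  ~~ balanced_component S F [set v | conn F x v] ->
  exists C y, [/\ unbalanced_cycle S C, C \subset F, y \in vertices C & conn F x y].
Proof.
move=> /asboolP/contrapT[C CF uC].
have [e eC] : exists e, e \in C.
  case: uC => -[z [p [np _ _ _ ->]]] _; case: p np => [//|[e y] p] _.
  by exists e; rewrite !inE eqxx.
exists C, (ends S e).1; split=> //.
- exact: subset_trans CF (component_edgesS F _).
- by have /andP[] := vertices_edge eC (joins_ends S e).
by have := subsetP CF e eC; rewrite !inE => /and3P[].
Qed.

(** Otherwise the first walk followed by the reverse of the second would be a closed odd walk, which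
    contains an unbalanced cycle. *)
Lemma balanced_walks F x p q : balanced_component S F [set v | conn F x v] ->
  walk x p -> walk x q -> {subset unzip1 p <= F} -> {subset unzip1 q <= F} ->
  walk_end x p = walk_end x q -> walk_neg S p = walk_neg S q.
Proof.
move=> /asboolP bal wp wq pF qF epq; apply/eqP/negPn/negP => npq; apply: bal.
apply: (@closed_odd_walk _ _ S _ x (p ++ rev_walk x q)).
- by rewrite walk_cat wp epq walk_rev.
- by rewrite walk_end_cat epq walk_end_rev.
- by rewrite walk_neg_cat walk_neg_rev; case: walk_neg npq; case: walk_neg.
have := walk_component_edges wp pF; have := walk_component_edges wq qF.
move=> qT pT e; rewrite unzip1_cat mem_cat unzip1_rev_walk mem_rev.
by case/orP=> [/pT|/qT].
Qed.

(** [X] collects the vertices reached from a root [r] by a negative walk. Balance makes the sign of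
    a walk from [r] depend only on its end, so an edge toggles membership exactly when it is
    negative. *)
Lemma switching_exists F T : T \in balanced_components S F ->
  exists X, is_switching S F T X.
Proof.
rewrite inE => /andP[/imsetP[r _ ->]]; set T' := [set v | _] => bal.
pose P z := exists p,
  [/\ walk r p, {subset unzip1 p <= F}, walk_end r p = z & walk_neg S p].
pose X := [set z in T' | `[< P z >]].
have XE p : walk r p -> {subset unzip1 p <= F} -> (walk_end r p \in X) = walk_neg S p.
  move=> wp pF; rewrite [LHS]inE inE (walk_conn wp pF (walk_end_mem _ _)) /=.
  apply/asboolP/idP => [[q [wq qF eq nq]]|np]; last by exists p.
  by rewrite (balanced_walks bal wp wq).
exists X; apply/andP; split.
  by apply/subsetP=> z; rewrite inE => /andP[].
apply/forall_inP=> e; rewrite inE => /and3P[eF]; rewrite inE => /conn_path[p pp pF] _.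
case/and3P: pp => wp /eqP ep _; rewrite -/(walk_end _ _) in ep.
set q := rcons p (e, (ends S e).2).
have eq : walk_end r q = (ends S e).2.
  by rewrite /q /walk_end /unzip2 map_rcons last_rcons.
have wq : walk r q by rewrite /q -cats1 walk_cat wp ep /= joins_ends.
have qF : {subset unzip1 q <= F}.
  by move=> f; rewrite /q -cats1 unzip1_cat mem_cat inE => /orP[/pF|/eqP->].
rewrite -eq -ep !XE // /q -cats1 walk_neg_cat walk_neg_cons.
by case: walk_neg; case: neg.
Qed.

(** The condition on the edges telescopes along the walk. *)
Lemma switching_walk F T X x p : is_switching S F T X ->
  walk x p -> {subset unzip1 p <= component_edges S F T} ->
  walk_neg S p = (x \in X) (+) (walk_end x p \in X).
Proof.
case/andP=> _ /forall_inP sw; elim: p x => [|[e y] p IHp] x /=.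
  by rewrite /walk_end /= addbb.
case/andP=> j wp pT; rewrite walk_neg_cons walk_end_cons (IHp y wp); last first.
  by move=> f fp; apply: pT; rewrite inE fp orbT.
have /eqP-> := sw e (pT e (mem_head _ _)).
have [[-> ->]|[-> ->]] := joins_pair (joins_ends S e) j;
  by case: (_ \in X); case: (_ \in X); case: (_ \in X).
Qed.

End Connectivity.

(** * Colorings violating a circuit, and Whitney's involution *)

Section Agreement.
Variables (V E : finType) (S : signed_graph V E) (c : V -> int).
Implicit Types (F G C D : {set E}) (p q : seq (E * V)).
Implicit Types (x y z u v w : V).

Local Notation walk := (walk S).
Local Notation joins := (joins S).
Local Notation is_path := (is_path S).
Local Notation vertices := (vertices S).

(* [agrees e] means that the coloring condition fails at [e]. *)
Definition agrees (e : E) : bool := c (ends S e).1 == sign S e * c (ends S e).2.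

Lemma agrees_joins e x y : joins e x y -> agrees e = (c x == (-1) ^+ neg S e * c y).
Proof.
move=> j; rewrite /agrees /sign.
have [[-> ->]//|[-> ->]] := joins_pair (joins_ends S e) j.
rewrite -(inj_eq (mulrI (unitrX (neg S e) (@unitrN1 int)))) mulrA -signr_addb.
by rewrite addbb mul1r eq_sym.
Qed.

Lemma agrees_walk x p : walk x p -> {in unzip1 p, forall e, agrees e} ->
  c x = (-1) ^+ walk_neg S p * c (walk_end x p).
Proof.
elim: p x => [|[e y] p IHp] x /=; first by rewrite mul1r.
case/andP=> j wp ag; rewrite walk_neg_cons walk_end_cons signr_addb -mulrA -IHp //.
  by apply/eqP; rewrite -agrees_joins // ag // mem_head.
by move=> f fp; apply: ag; rewrite inE fp orbT.
Qed.

(** Agreeing edges preserve the absolute value of [c], so a zero spreads along the whole walk. *)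
Lemma agrees_walk0 x p y z : walk x p -> {in unzip1 p, forall e, agrees e} ->
  y \in x :: unzip2 p -> c y = 0 -> z \in x :: unzip2 p -> c z = 0.
Proof.
move=> wp ag.
have normE w : w \in x :: unzip2 p -> `|c w| = `|c x|.
  case/walk_split=> p1 [p2 [def_p <-]].
  move: wp; rewrite def_p walk_cat => /andP[w1 _].
  rewrite (agrees_walk w1) ?normrMsign // => e e1.
  by apply: ag; rewrite def_p unzip1_cat mem_cat e1.
by move=> /normE ny y0 /normE nz; apply/normr0_eq0; rewrite nz -ny y0 normr0.
Qed.

(** One turn around the cycle yields [c x = - c x]. *)
Lemma unbalanced_cycle0 C x : unbalanced_cycle S C -> {in C, forall e, agrees e} ->
  x \in vertices C -> c x = 0.
Proof.
move=> [cC oC] ag /(cycle_vertex cC)[m [u [q dC]]].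
have := odd_neg_cycle dC; rewrite oC; case: dC => j pq _ defC /esym odd_q.
case/and3P: pq => wq /eqP eq _; rewrite -/(walk_end _ _) in eq.
have agq : {in unzip1 q, forall e, agrees e}.
  by move=> e eq'; apply: ag; rewrite defC !inE eq' orbT.
have := ag m; rewrite defC setU11 => /(_ isT); rewrite (agrees_joins j) => /eqP cu.
have := agrees_walk wq agq; rewrite eq cu mulrA -signr_addb addbC odd_q expr1 mulN1r.
by move/eqP; rewrite -addr_eq0 -mulr2n mulrn_eq0 /= => /eqP.
Qed.

(** Without [m] the cycle is still a path through all its vertices, along which the zero spreads to
    both ends of [m]. *)
Lemma cycle_agrees0 C m x : is_cycle S C -> m \in C ->
  {in C, forall e, e != m -> agrees e} -> x \in vertices C -> c x = 0 -> agrees m.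
Proof.
move=> cC mC ag; have [u [v [q [j pq nm defC]]]] := cycle_edge cC mC.
rewrite defC (vertices_path j pq) inE => xq x0.
case/and3P: (pq) => wq /eqP eq _; rewrite -/(walk_end _ _) in eq.
have agq : {in unzip1 q, forall e, agrees e}.
  move=> e eq'; apply: ag; first by rewrite defC !inE eq' orbT.
  by apply: contraNneq nm => <-.
have cu : c u = 0 by apply: agrees_walk0 wq agq xq x0 _; rewrite -eq walk_end_mem.
have cv : c v = 0 by apply: agrees_walk0 wq agq xq x0 _; rewrite mem_head.
by rewrite (agrees_joins j) cu cv mulr0.
Qed.

(** The path left after removing [m] has the same sign as [m] and relates the colors of its ends by
    that sign. *)
Lemma balanced_cycle_agrees C m : balanced_cycle S C -> m \in C ->
  {in C, forall e, e != m -> agrees e} -> agrees m.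
Proof.
move=> [cC oC] mC ag; have [u [v [q dC]]] := cycle_edge cC mC.
have := odd_neg_cycle dC; rewrite (negPf oC); case: dC => j pq nm defC /esym odd_q.
case/and3P: (pq) => wq /eqP eq _; rewrite -/(walk_end _ _) in eq.
rewrite (agrees_joins j) (agrees_walk wq) ?eq ?mulrA -?signr_addb ?odd_q ?mul1r //.
move=> e eq'; apply: ag; first by rewrite defC !inE eq' orbT.
by apply: contraNneq nm => <-.
Qed.

Lemma cycle_loop C m x : is_cycle S C -> m \in C -> joins m x x -> C = [set m].
Proof.
move=> cC mC jx; have [u [v [q [j pq nm defC]]]] := cycle_edge cC mC.
have euv : u = v by have [[-> ->]|[-> ->]] := joins_pair j jx.
rewrite euv in pq; rewrite defC (path_closed pq).
by apply/setP=> e; rewrite !inE orbF.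
Qed.

Lemma ends_mem C m : m \in C ->
  ((ends S m).1 \in vertices C) && ((ends S m).2 \in vertices C).
Proof. by move=> mC; apply: vertices_edge mC (joins_ends S m). Qed.

Lemma joins_loop m x : (ends S m).1 = x -> (ends S m).2 = x -> joins m x x.
Proof. by move=> e1 e2; rewrite -{1}e1 -e2 joins_ends. Qed.

(** An unbalanced cycle avoiding [m] is colored 0, and the path carries zeros. If [m] lies on one
    cycle, the zero of the other reaches its attaching vertex and spreads over it; if [m] lies on
    the path, the zeros at [v1] and [v2] reach the two ends of [m]. *)
Lemma barbell_agrees D m : is_barbell S D -> m \in D ->
  {in D, forall e, e != m -> agrees e} -> agrees m.
Proof.
case=> C1 [C2 [v1 [v2 [p [[u1 u2 n12] [pp v1C v2C] d1 d2 ->]]]]].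
have C1v1 z : z \in vertices C1 ->
    z \in v1 :: unzip2 p \/ z \in vertices C2 -> z = v1.
  move=> z1 z2; apply/eqP; apply: contraTT d1 => nz; apply/pred0Pn; exists z.
  by rewrite /= in_setD1 nz z1 in_setU [z \in [set _ in _]]inE; apply/orP.
have C2v2 z : z \in vertices C2 ->
    z \in v1 :: unzip2 p \/ z \in vertices C1 -> z = v2.
  move=> z1 z2; apply/eqP; apply: contraTT d2 => nz; apply/pred0Pn; exists z.
  by rewrite /= in_setD1 nz z1 in_setU [z \in [set _ in _]]inE; apply/orP.
(* The three pieces share no edge: both ends of a common edge would be the attaching vertex, making
   it a loop. Then both cycles would be [[set m]], while a path has no loop. *)
have n1 : m \in C1 -> m \notin C2.
  move=> m1; apply/negP => m2.
  have /andP[a1 b1] := ends_mem m1; have /andP[a2 b2] := ends_mem m2.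
  have j := joins_loop (C1v1 _ a1 (or_intror a2)) (C1v1 _ b1 (or_intror b2)).
  by case/eqP: n12; rewrite (cycle_loop u1.1 m1 j) (cycle_loop u2.1 m2 j).
case/and3P: (pp) => wp /eqP ep up; rewrite -/(walk_end _ _) in ep.
have np1 : m \in C1 -> m \notin unzip1 p.
  move=> m1; apply/negP => mp; have /andP[a1 b1] := ends_mem m1.
  have /andP[a2 b2] := walk_edge_mem wp mp.
  have j := joins_loop (C1v1 _ a1 (or_introl a2)) (C1v1 _ b1 (or_introl b2)).
  by have := path_no_loop v1 pp mp; rewrite j.
have np2 : m \in C2 -> m \notin unzip1 p.
  move=> m1; apply/negP => mp; have /andP[a1 b1] := ends_mem m1.
  have /andP[a2 b2] := walk_edge_mem wp mp.
  have j := joins_loop (C2v2 _ a1 (or_introl a2)) (C2v2 _ b1 (or_introl b2)).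
  by have := path_no_loop v2 pp mp; rewrite j.
move=> mD ag.
have ag1 : {in C1, forall e, e != m -> agrees e}.
  by move=> e e1; apply: ag; rewrite !inE e1.
have ag2 : {in C2, forall e, e != m -> agrees e}.
  by move=> e e1; apply: ag; rewrite !inE e1 orbT.
have agp (q : seq E) : {subset q <= unzip1 p} -> m \notin q -> {in q, forall e, agrees e}.
  move=> qp nm e eq; apply: ag; first by rewrite !inE qp // !orbT.
  by apply: contraNneq nm => <-.
have z1 : m \notin C1 -> c v1 = 0.
  move=> nm; apply: unbalanced_cycle0 u1 _ v1C => e e1; apply: ag1 => //.
  by apply: contraNneq nm => <-.
have z2 : m \notin C2 -> c v2 = 0.
  move=> nm; apply: unbalanced_cycle0 u2 _ v2C => e e1; apply: ag2 => //.
  by apply: contraNneq nm => <-.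
have v2p : v2 \in v1 :: unzip2 p by rewrite -ep walk_end_mem.
have v1p := mem_head v1 (unzip2 p).
move: mD; rewrite !inE -orbA => /or3P[m1|m2|mp].
- apply: (cycle_agrees0 u1.1 m1 ag1 v1C _).
  exact: agrees_walk0 wp (agp _ _ (np1 m1)) v2p (z2 (n1 m1)) v1p.
- apply: (cycle_agrees0 u2.1 m2 ag2 v2C _).
  have m1 : m \notin C1 by apply: contraTN m2 => /n1.
  exact: agrees_walk0 wp (agp _ _ (np2 m2)) v1p (z1 m1) v2p.
have {}z1 : c v1 = 0 by apply: z1; apply: contraTN mp => /np1.
have {}z2 : c v2 = 0 by apply: z2; apply: contraTN mp => /np2.
have [p1 [y [p2 def_p]]] := edge_split mp.
move: wp (path_uniq_edges pp); rewrite {1 2}def_p walk_cat unzip1_cat => /and3P[w1 j w2].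
rewrite cat_uniq /= negb_or => /and4P[_ /andP[m1 _] m2 _].
rewrite (agrees_joins j).
have -> : c (walk_end v1 p1) = 0.
  apply: agrees_walk0 w1 (agp _ _ m1) (mem_head _ _) z1 (walk_end_mem _ _).
  by move=> e e1; rewrite def_p unzip1_cat mem_cat e1.
have -> : c y = 0; last by rewrite mulr0.
apply: agrees_walk0 w2 (agp _ _ m2) (walk_end_mem _ _) _ (mem_head _ _).
  by move=> e e2; rewrite def_p unzip1_cat mem_cat !inE e2 !orbT.
by rewrite -z2 -ep def_p walk_end_cat walk_end_cons.
Qed.

Lemma circuit_agrees C m : is_circuit S C -> m \in C ->
  {in C, forall e, e != m -> agrees e} -> agrees m.
Proof. by case; [apply: balanced_cycle_agrees | apply: barbell_agrees]. Qed.

Lemma cycle_neq0 C : is_cycle S C -> C != set0.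
Proof.
case=> x [[|[e y] p] [np _ _ _ ->]] //.
by apply/set0Pn; exists e; rewrite !inE eqxx.
Qed.

Lemma circuit_neq0 C : is_circuit S C -> C != set0.
Proof.
case=> [[/cycle_neq0//]|[C1 [C2 [? [? [? [[[/cycle_neq0 n1 _] _ _] _ _ _ ->]]]]]]].
by rewrite -setUA; apply: contraNneq n1 => /eqP; rewrite setU_eq0 => /andP[/eqP->].
Qed.

(** * Broken circuits and the sign-reversing involution *)

Section Order.
Variable le : rel E.
Hypotheses (le_total : total le) (le_anti : antisymmetric le)
           (le_trans : transitive le).

Lemma max_edge C : C != set0 -> exists2 m, m \in C & forall e, e \in C -> le e m.
Proof.
case/set0Pn=> e0 e0C.
have rr : reflexive le by move=> e; have := le_total e e; rewrite orbb.
pose ge : rel E := fun e f => le f e.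
have ge_refl : reflexive ge by [].
have ge_trans : transitive ge by move=> e f g; rewrite /ge => fe eg; apply: le_trans eg fe.
have ge_total : total ge by move=> e f; apply: le_total.
have [m mC mx] := @extremumP _ _ ge e0 (mem C) id ge_refl ge_trans ge_total e0C.
by exists m.
Qed.

Lemma nbcP F : reflect (forall C m, is_circuit S C -> m \in C ->
    (forall e, e \in C -> le e m) -> ~~ (C :\ m \subset F)) (F \in nbc S le).
Proof.
apply: (iffP idP) => [|H]; first (rewrite inE => /asboolP H C m cC mC mx).
  by apply/negP => sub; apply: H; exists (C :\ m) => //; exists C, m.
rewrite inE; apply/asboolP => -[B [C [m [cC mC mx ->]]] sub].
by have := H C m cC mC mx; rewrite sub.
Qed.

Lemma nbc_circuit_free F C : F \in nbc S le -> is_circuit S C -> ~~ (C \subset F).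
Proof.
move=> /nbcP nF cC; have [m mC mx] := max_edge (circuit_neq0 cC).
by apply: contra (nF C m cC mC mx); apply: subset_trans; rewrite subsetDl.
Qed.

(* Toggling the largest edge a of A := [set e | agrees e] preserves membership
   in [nbc]: a broken circuit inside A comes from a circuit inside A, so it
   avoids a. *)
Lemma nbc_alternating_sum :
  \sum_(F in nbc S le | F \subset [set e | agrees e]) (-1) ^+ #|F| =
  ([forall e, ~~ agrees e] : nat)%:Z.
Proof.
set A := [set e | agrees e].
have flat C m : is_circuit S C -> m \in C -> C :\ m \subset A -> m \in A.
  move=> cC mC /subsetP sub; rewrite inE; apply: circuit_agrees cC mC _ => e eC em.
  by have := sub e; rewrite !inE em eC; apply.
have [A0|nA0] := eqVneq A set0.
  rewrite (_ : [forall e, _] = true); last first.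
    by apply/forallP=> e; have := in_set0 e; rewrite -A0 inE => ->.
  rewrite (big_pred1 set0) ?cards0 // => F; rewrite A0 subset0 /=.
  apply: andb_idl => /eqP->; apply/nbcP => C m cC mC _; rewrite -A0.
  by apply/negP => /(flat _ _ cC mC); rewrite A0 inE.
have [a aA amax] := max_edge nA0.
rewrite (_ : [forall e, _] = false); last first.
  by apply/negbTE/forallPn; exists a; rewrite negbK; rewrite inE in aA.
pose tog F := if a \in F then F :\ a else a |: F.
have togK : involutive tog.
  move=> F; rewrite /tog; case: (boolP (a \in F)) => aF.
    by rewrite setD11 setD1K.
  by rewrite setU11 setU1K.
have tog_sub F G : a \notin G -> (G \subset tog F) = (G \subset F).
  move=> aG; rewrite /tog; case: ifP => aF.
    by rewrite subsetD1 aG andbT.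
  apply/idP/idP => [/subsetP sub|/subset_trans]; last by apply; rewrite subsetUr.
  apply/subsetP=> e eG; have := sub e eG; rewrite !inE => /predU1P[ea|//].
  by rewrite -ea eG in aG.
have tog_A F : (tog F \subset A) = (F \subset A).
  rewrite /tog; case: ifP => aF; last by rewrite subUset sub1set aA.
  by rewrite subDset (setUidPr _) // sub1set.
have tog_nbc F : F \subset A -> (tog F \in nbc S le) = (F \in nbc S le).
  (* If [C :\ m] lies in [A], then so does [m]. Hence if [a] is in [C], each of [a] and [m]
     dominates the other, so [a] is the removed edge. *)
  move=> FA; have aux G : G \subset A -> forall C m, is_circuit S C -> m \in C ->
      (forall e, e \in C -> le e m) -> C :\ m \subset G -> a \notin C :\ m.
    move=> GA C m cC mC mx sub; have mA := flat C m cC mC (subset_trans sub GA).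
    rewrite !inE negb_and negbK; case: (boolP (a \in C)) => [aC|]; last by rewrite orbT.
    by rewrite orbF; apply/eqP/le_anti; rewrite amax // mx.
  apply/nbcP/nbcP => H C m cC mC mx; apply/negP => sub.
    have aCm := aux _ FA C m cC mC mx sub.
    by have := H C m cC mC mx; rewrite tog_sub // sub.
  have GA : tog F \subset A by rewrite tog_A.
  have aCm := aux _ GA C m cC mC mx sub.
  by have := H C m cC mC mx; rewrite -tog_sub // sub.
have tog_sign F : (-1) ^+ #|tog F| = - (-1) ^+ #|F| :> int.
  rewrite /tog; case: ifP => aF.
    by rewrite (cardsD1 a F) aF add1n exprS mulN1r opprK.
  by rewrite cardsU1 aF add1n exprS mulN1r.
set s := \sum_(F in _ | _) _.
suff : s = - s by move/eqP; rewrite -addr_eq0 -mulr2n mulrn_eq0 /= => /eqP.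
rewrite {1}/s (reindex_inj (inv_inj togK)) /= -sumrN; apply: eq_big => F.
  by rewrite tog_A; case FA: (F \subset A); rewrite ?andbF // tog_nbc.
by rewrite tog_sign.
Qed.

End Order.
End Agreement.

(** * Colorings violating a given set of edges *)

Section Counting.
Variables (V E : finType) (S : signed_graph V E) (L : V -> {fset int}).
Implicit Types (F : {set E}) (T X : {set V}).

Local Notation coloring := {dffun forall v : V, L v}.

Definition agreeing (c : coloring) : {set E} :=
  [set e | agrees S (fun v => val (c v)) e].

Definition num_agreeing F : nat := #|[set c : coloring | F \subset agreeing c]|.

(** For each choice [c] from the lists, the alternating sum over the sets it violates entirely is 1
    if [c] is a coloring and 0 otherwise. Exchanging the two sums then counts, for each [F], the
    choices violating it. *)
Lemma num_colorings_nbc (le : rel E) :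
  total le -> antisymmetric le -> transitive le ->
  (num_colorings S L)%:Z =
  \sum_(F in nbc S le) (-1) ^+ #|F| * (num_agreeing F)%:Z.
Proof.
move=> le_total le_anti le_trans.
transitivity (\sum_(c : coloring)
   \sum_(F in nbc S le | F \subset agreeing c) (-1) ^+ #|F| : int).
  rewrite /num_colorings -sum1_card -natz natr_sum big_mkcond /=.
  apply: eq_bigr => c _; rewrite nbc_alternating_sum // inE.
  by set b := [forall e, _]; case: b.
rewrite (exchange_big_dep (mem (nbc S le))) /=; last by move=> c F _ /andP[].
apply: eq_bigr => F nF.
have -> : (num_agreeing F)%:Z = \sum_(c : coloring | F \subset agreeing c) 1.
  rewrite /num_agreeing -sum1_card -natz natr_sum.
  by apply: eq_bigl => c; rewrite inE.
by rewrite mulr_sumr; apply: eq_big => [c|c _]; rewrite ?mulr1 // nF.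
Qed.

Lemma mem_switched_list X v a :
  (a \in switched_list L X v) = ((-1) ^+ (v \in X) * a \in L v).
Proof.
rewrite /switched_list; case: (v \in X); rewrite ?mul1r // expr1 mulN1r.
apply/imfsetP/idP => [[b /= bL ->]|aL]; first by rewrite opprK.
by exists (- a); rewrite ?opprK.
Qed.

Hypothesis L_neq0 : forall v, L v != fset0.

(** Choices violating all of [F] correspond to families picking one common element of the switched
    lists on each balanced component: the color at [v] is that element up to the switching sign, and
    0 on unbalanced components. A missing 0 on an unbalanced component leaves no choice at all. *)
Lemma num_agreeingE F :
  num_agreeing F =
  (gamma S L F * \prod_(T in balanced_components S F) beta S L F T)%N.
Proof.
pose conn := connect (adjacent S F); pose cmp v := [set w | conn v w].
have cmp_id v : v \in cmp v by rewrite inE /conn connect0.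
have zero_unbal (c : coloring) v : F \subset agreeing c ->
    ~~ balanced_component S F (cmp v) -> val (c v) = 0.
  move=> /subsetP ag /unbalanced_componentP[C [y [uC /subsetP CF yC vy]]].
  have y0 := unbalanced_cycle0 (c := fun v => val (c v)) uC _ yC.
  have [p /and3P[wp /eqP ep _] pF] := conn_path vy.
  apply: (agrees_walk0 (c := fun v => val (c v)) wp _ _ _ (mem_head _ _)).
  - by move=> e /pF/ag; rewrite inE.
  - exact: (walk_end_mem v p).
  - by rewrite /walk_end ep; apply: y0 => e /CF/ag; rewrite inE.
rewrite /gamma; case: ifPn => [/exists_inP[T TF /andP[unb /exists_inP[v vT v0]]]|].
  rewrite mul0n; apply/eqP; rewrite cards_eq0; apply/eqP/setP=> c; rewrite !inE.
  apply/negP => ag; rewrite (componentP TF vT) in unb.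
  by have := valP (c v); rewrite (zero_unbal c v ag unb) (negPf v0).
rewrite negb_exists => /forallP zero_ok; rewrite mul1n.
have {}zero_ok v : ~~ balanced_component S F (cmp v) -> 0 \in L v.
  have := zero_ok (cmp v); rewrite component_in => /= H unb; move: H.
  rewrite unb /= negb_exists => /forallP/(_ v).
  by rewrite cmp_id negbK.
(* This repeats the choice made in [beta]; the default [set0] is never reached on balanced
   components. *)
pose sw T := odflt set0 [pick X | is_switching S F T X].
have swP T : T \in balanced_components S F -> is_switching S F T (sw T).
  move=> /switching_exists[X HX]; rewrite /sw; case: pickP => [//|/(_ X)].
  by rewrite HX.
pose I T := [fset a in (\bigcup_(v in T) switched_list L (sw T) v)%fset
          | [forall v in T, a \in switched_list L (sw T) v]]%fset.
have betaE T : T \in balanced_components S F -> beta S L F T = #|` I T|.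
  move=> /swP; rewrite /beta /I /sw; case: pickP => [X _ //|/= no].
  by rewrite no.
have memI T v a : v \in T ->
    (a \in I T) = [forall w in T, (-1) ^+ (w \in sw T) * a \in L w].
  move=> vT; rewrite !inE /=.
  have -> : [forall w in T, (-1) ^+ (w \in sw T) * a \in L w] =
            [forall w in T, a \in switched_list L (sw T) w].
    by apply: eq_forallb => w; rewrite mem_switched_list.
  apply: andb_idl => /forall_inP H.
  by apply/bigfcupP; exists v; rewrite ?vT ?H // mem_index_enum.
(* [pfamily] needs a single finite codomain: [U] collects all the common lists, and 0 serves as the
   value off the balanced components. *)
pose U : {fset int} := (0 |` \bigcup_(T <- index_enum {set V}) I T)%fset.
have U0 : 0 \in U by rewrite !inE.
have IU T a : a \in I T -> a \in U.
  move=> aT; rewrite in_fset1U; apply/orP; right.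
  by apply/bigfcupP; exists T => //; rewrite mem_index_enum.
pose z0 : U := [` U0]%fset.
pose Fam T := [pred a : U | val a \in I T].
pose D := [pred T | T \in balanced_components S F].
have DE T : (T \in D) = (T \in balanced_components S F) by [].
have -> : (\prod_(T in balanced_components S F) beta S L F T)%N = #|pfamily z0 D Fam|.
  rewrite card_pfamily foldrE big_map big_enum /=; apply: eq_bigr => T TB.
  rewrite betaE // cardfE.
  rewrite -(card_in_imset (f := fun a : I T => [` IU T _ (valP a)]%fset)); last first.
    by move=> a b _ _ /(congr1 val) /= /val_inj.
  apply: eq_card => a; rewrite [RHS]inE; apply/imsetP/idP => [[b _ ->]|aI].
    exact: valP b.
  by exists [` aI]%fset => //; apply: val_inj.
pose value (f : {set V} -> int) v : int :=
  if balanced_component S F (cmp v) then (-1) ^+ (v \in sw (cmp v)) * f (cmp v) else 0.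
(* The default only makes [G] total: on members of the family the value already lies in [L v], as
   [GE] shows. *)
pose dflt v : L v := [` xchooseP (fset0Pn _ (L_neq0 v))]%fset.
pose G (f : {ffun {set V} -> U}) : coloring :=
  [ffun v => insubd (dflt v) (value (fun T => val (f T)) v)].
have cmpB v : (cmp v \in balanced_components S F) = balanced_component S F (cmp v).
  by rewrite inE component_in.
have GE f v : f \in pfamily z0 D Fam -> val (G f v) = value (fun T => val (f T)) v.
  move=> /pfamilyP[_ fI]; rewrite ffunE val_insubd.
  rewrite ifT //; rewrite /value; case: ifPn => [bal|/zero_ok//].
  have : f (cmp v) \in Fam (cmp v) by apply: fI; rewrite DE cmpB.
  by rewrite inE (memI _ v) ?cmp_id // => /forall_inP/(_ v (cmp_id v)).
have sgnK (b : bool) (a : int) : (-1) ^+ b * ((-1) ^+ b * a) = a.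
  by rewrite mulrA -signr_addb addbb mul1r.
(* Injectivity of [G]: on a balanced component the switching sign cancels at any vertex, and on sets
   outside [D] both families equal [z0]. *)
rewrite -(card_in_imset (f := G)); last first.
  move=> f g fP gP eqG; apply/ffunP=> T; have [TB|nTB] := boolP (T \in D).
    have /andP[/imsetP[v _ defT] bal] : (T \in components S F) && balanced_component S F T.
      by move: TB; rewrite DE inE.
    have {}defT : T = cmp v by [].
    have := congr1 (fun c : coloring => val (c v)) eqG; rewrite /= !GE // /value.
    rewrite -defT bal => /(congr1 (fun a => (-1) ^+ (v \in sw T) * a)).
    by rewrite !sgnK => /val_inj.
  have supp h : h \in pfamily z0 D Fam -> h T = z0.
    move=> /pfamilyP[sup _]; apply/eqP; apply: contraNT nTB => hT.
    by apply: (subsetP sup); rewrite inE.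
  by rewrite !supp.
apply: eq_card => c; rewrite inE; apply/idP/imsetP => [ag|[f fP ->]]; last first.
  apply/subsetP=> e eF; rewrite inE /agrees !GE //.
  have ee : conn (ends S e).1 (ends S e).2 by apply: conn_edge eF (joins_ends S e).
  have ecmp : cmp (ends S e).2 = cmp (ends S e).1.
    by apply/esym/componentP; rewrite ?component_in // inE.
  rewrite /value ecmp; case: ifP => [bal|_]; last by rewrite mulr0.
  have /andP[_ /forall_inP sw_e] : is_switching S F (cmp (ends S e).1) (sw (cmp (ends S e).1)).
    by apply: swP; rewrite cmpB.
  have eT : e \in component_edges S F (cmp (ends S e).1) by rewrite inE eF cmp_id inE.
  by rewrite /sign (eqP (sw_e e eT)) signr_addb -mulrA sgnK.
have /subsetP ag' := ag.
(* The sign of an [F]-walk inside [T] is exactly the change of switching sign between its ends, so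
   the color times its switching sign is constant on [T]. *)
have const T v w : T \in balanced_components S F -> v \in T -> w \in T ->
    (-1) ^+ (v \in sw T) * val (c v) = (-1) ^+ (w \in sw T) * val (c w) :> int.
  move=> TB vT wT; have TC : T \in components S F by move: TB; rewrite inE => /andP[].
  have defT := componentP TC vT; rewrite defT inE in wT.
  have [p /and3P[wp /eqP ep _] pF] := conn_path wT.
  have /(agrees_walk (c := fun v => val (c v)) wp) :
      {in unzip1 p, forall e, agrees S (fun v => val (c v)) e}.
    by move=> e /pF/ag'; rewrite inE.
  have pT : {subset unzip1 p <= component_edges S F T}.
    by rewrite defT; apply: walk_component_edges.
  rewrite (switching_walk (swP T TB) wp pT) /walk_end ep => ->.
  by rewrite mulrA -signr_addb addbA addbb.
(* The preimage of [c] under [G]: read the switched color at any vertex of [T]. *)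
pose f := [ffun T => insubd z0 (if T \in D then
     (if [pick v in T] is Some v then (-1) ^+ (v \in sw T) * val (c v) else 0) else 0)]
  : {ffun {set V} -> U}.
have fE T v : T \in balanced_components S F -> v \in T ->
    val (f T) = (-1) ^+ (v \in sw T) * val (c v) /\ val (f T) \in I T.
  move=> TB vT.
  have cI : (-1) ^+ (v \in sw T) * val (c v) \in I T.
    rewrite (memI _ v) //; apply/forall_inP=> w wT.
    by rewrite (const T v w) // sgnK; apply: valP.
  suff -> : val (f T) = (-1) ^+ (v \in sw T) * val (c v) by [].
  rewrite ffunE DE TB; case: pickP => [w wT|/(_ v)]; last by rewrite vT.
  by rewrite (const T w v) // val_insubd (IU _ _ cI).
have fP : f \in pfamily z0 D Fam.
  apply/pfamilyP; split=> [|T TD].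
    apply/subsetP=> T; rewrite inE ffunE; case: ifP => // _.
    have -> : insubd z0 0 = z0 by apply: val_inj; rewrite val_insubd U0.
    by rewrite eqxx.
  have TB : T \in balanced_components S F by rewrite -DE.
  have : T \in components S F by move: TB; rewrite inE => /andP[].
  by case/imsetP=> v _ defT; have [] := fE T v TB; rewrite ?inE // defT; exact: cmp_id.
exists f => //; apply/ffunP=> v; apply: val_inj; rewrite GE // /value.
case: ifPn => [bal|unb]; last by rewrite zero_unbal.
by have [-> _] := fE (cmp v) v (etrans (cmpB v) bal) (cmp_id v); rewrite sgnK.
Qed.

End Counting.

(** * Balanced components of circuit-free edge sets *)

Section Rank.
Variables (V E : finType) (S : signed_graph V E).
Implicit Types (F C D : {set E}) (p q : seq (E * V)) (x y z u v w : V).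

Local Notation walk := (walk S).
Local Notation joins := (joins S).
Local Notation is_path := (is_path S).
Local Notation vertices := (vertices S).
Local Notation conn F := (connect (adjacent S F)).

Lemma balanced_cycle_path F e u v q : e \notin F -> joins e u v -> is_path v u q ->
  {subset unzip1 q <= F} -> walk_neg S q = neg S e ->
  exists2 D : {set E}, D \subset e |: F & is_circuit S D.
Proof.
move=> eF j pq qF nq; have nein : e \notin unzip1 q by apply: contra eF => /qF.
exists (e |: [set f in unzip1 q]).
  by apply: setUS; apply/subsetP=> f; rewrite inE => /qF.
left; split; first exact: cycle_of_path j pq nein.
have dC : cycle_decomposition S (e |: [set f in unzip1 q]) e u v q by split.
by rewrite (odd_neg_cycle dC) nq addbb.
Qed.

(** Replace the part of [q] between its first and its last vertex on [C] by an arc of [C]. The two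
    arcs have opposite signs, so one of them realizes [b]. *)
Lemma reroute F C u v q z z' (b : bool) :
  is_path v u q -> {subset unzip1 q <= F} -> unbalanced_cycle S C -> C \subset F ->
  z \in vertices C -> z' \in vertices C -> z \in v :: unzip2 q ->
  z' \in v :: unzip2 q -> z != z' ->
  exists2 q', is_path v u q' & {subset unzip1 q' <= F} /\ walk_neg S q' = b.
Proof.
move=> pq qF uC /subsetP CF zC z'C zq z'q nz.
have h1 : has (mem (vertices C)) (v :: unzip2 q) by apply/hasP; exists z.
have [q1 [q2 [def_q aC fst]]] := first_hit h1.
have h2 : has (mem (vertices C)) (walk_end v q1 :: unzip2 q2).
  by apply/hasP; exists (walk_end v q1); rewrite ?mem_head.
have [q3 [q4 [def_q2 wC lst]]] := last_hit h2.
rewrite {}def_q2 {h1 h2} in def_q.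
set a := walk_end v q1 in aC fst wC; set w := walk_end a q3 in wC.
move: pq zq z'q qF; rewrite def_q => pq zq z'q qF.
have [p1 p34] := is_path_cat pq; have [p3 p4] := is_path_cat p34.
(* If the first and the last meeting vertex coincided, the path would meet [C] only there, against
   [z != z']. *)
have aw : a != w.
  apply: contra nz => /eqP eaw; rewrite -/a -/w -eaw in p3.
  have q30 := path_closed p3.
  have only t : t \in vertices C -> t \in v :: unzip2 (q1 ++ q3 ++ q4) -> t = a.
    move=> tC; rewrite q30 /= unzip2_cat -cat_cons mem_cat => /orP[tq1|/lst].
      exact: fst.
    by rewrite /= tC.
  by rewrite (only z) // (only z').
have [r [r' [pr pr' nrr rC rV]]] := cycle_arcs uC aC wC aw.
(* The outer parts [q1] and [q4] meet [C] at most in [a] and [w], so splicing in a path inside [C]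
   repeats no vertex. *)
have main p : is_path a w p -> {subset unzip1 p <= C} ->
    {subset unzip2 p <= vertices C} ->
    is_path v u (q1 ++ p ++ q4) /\ {subset unzip1 (q1 ++ p ++ q4) <= F}.
  move=> pp pC pV; split; last first.
    move=> f; rewrite !unzip1_cat !mem_cat => /or3P[fq|/pC/CF//|fq];
      by apply: qF; rewrite !unzip1_cat !mem_cat fq ?orbT.
  case/and3P: pq => _ _; rewrite !unzip2_cat -cat_cons cat_uniq => /and3P[_ d1 _].
  case/and3P: p1 => w1 e1 uq1; case/and3P: p4 => w4 e4 /= /andP[_ uq4].
  case/and3P: pp => wp /eqP ep /= /andP[np up]; rewrite -/(walk_end _ _) in ep.
  apply/and3P; split.
  - by rewrite !walk_cat w1 wp ep.
  - by rewrite -/(walk_end _ _) !walk_end_cat ep.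
  rewrite !unzip2_cat -cat_cons cat_uniq uq1 cat_uniq up uq4 andbT /=.
  apply/andP; split; apply/hasPn => t.
    rewrite mem_cat => /orP[tp|tq4]; apply/negP => t1.
      by case/negP: np; rewrite -(fst t t1 (pV t tp)).
    by case/hasP: d1; exists t => //; rewrite mem_cat tq4 orbT.
  by move=> /lst; apply: contra => /pV.
have subl : {subset unzip1 r <= C} by move=> f fr; apply: rC; rewrite mem_cat fr.
have subr : {subset unzip1 r' <= C} by move=> f fr; apply: rC; rewrite mem_cat fr orbT.
have vsl : {subset unzip2 r <= vertices C} by move=> f fr; apply: rV; rewrite mem_cat fr.
have vsr : {subset unzip2 r' <= vertices C}.
  by move=> f fr; apply: rV; rewrite mem_cat fr orbT.
have [pl lF] := main r pr subl vsl; have [pr1 rF] := main r' pr' subr vsr.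
have [el|nl] := eqVneq (walk_neg S (q1 ++ r ++ q4)) b.
  by exists (q1 ++ r ++ q4).
exists (q1 ++ r' ++ q4) => //; split=> //; move: nl nrr; rewrite !walk_neg_cat.
by do 3!case: walk_neg; case: walk_neg; case: b.
Qed.

(** This list is stable under negation, so switching does not change it, and its elements represent
    the residues modulo 3. *)
Definition signs : {fset int} := [fset -1; 0; 1]%fset.

Lemma signs0 : 0 \in signs. Proof. by rewrite !inE. Qed.

Lemma signs_sign (b : bool) : (-1) ^+ b \in signs.
Proof. by rewrite !inE; case: b. Qed.

(** If an end of [e] has a balanced component, a test coloring supported there shows that [e] closes
    a balanced cycle. Otherwise unbalanced cycles are reachable from both ends, and they lead to a
    barbell unless some path between the ends closes a balanced cycle with [e]. *)
Lemma closed_edge_circuit F e : e \notin F ->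
  (forall c : V -> int, (forall v, c v \in signs) ->
     {in F, forall f, agrees S c f} -> agrees S c e) ->
  exists2 D : {set E}, D \subset e |: F & is_circuit S D.
Proof.
move=> eF closed.
have balcase x y : joins e x y -> balanced_component S F [set w | conn F x w] ->
    exists2 D : {set E}, D \subset e |: F & is_circuit S D.
  move=> j bal; set T := [set w | conn F x w] in bal.
  have TB : T \in balanced_components S F by rewrite inE component_in.
  have [X swX] := switching_exists TB.
  (* The test coloring is the switching sign on the component of [x] and 0 elsewhere. It agrees on
     [F], and agreement at [e] puts [y] in the same component with the parity that makes a path back
     to [y] close a balanced cycle. *)
  pose c w : int := if conn F x w then (-1) ^+ (w \in X) else 0.
  have /closed : forall v, c v \in signs.
    by move=> v; rewrite /c; case: ifP => _; rewrite ?signs_sign ?signs0.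
  have agF : {in F, forall f, agrees S c f}.
    move=> f fF; rewrite /agrees /c.
    have ff := conn_edge fF (joins_ends S f).
    rewrite (same_connect_r (@connC _ _ S F) ff); case: ifP => xf; last by rewrite mulr0.
    case/andP: swX => _ /forall_inP/(_ f) sw; rewrite /sign (eqP (sw _)); last first.
      by rewrite !inE fF xf (same_connect_r (@connC _ _ S F) ff) xf.
    by rewrite -signr_addb -addbA addbb addbF.
  move=> /(_ agF); rewrite (agrees_joins c j) /c connect0.
  case: ifP => [xy|_]; last by rewrite mulr0 signr_eq0.
  rewrite -signr_addb => /eqP/signr_inj xX.
  have [q pq qF] := conn_path xy.
  have jC : joins e y x by rewrite joinsC.
  apply: (balanced_cycle_path eF jC pq qF).
  case/and3P: pq => wq /eqP eq _.
  rewrite (switching_walk swX wq) ?/walk_end ?eq; last exact: walk_component_edges.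
  by rewrite xX -addbA addbb addbF.
set u := (ends S e).1; set v := (ends S e).2; have j : joins e u v := joins_ends S e.
have [/(balcase u v j)//|/unbalanced_componentP[C1 [y1 [u1 C1F y1C uy1]]]] :=
  boolP (balanced_component S F [set w | conn F u w]).
have jC : joins e v u by rewrite joinsC.
have [/(balcase v u jC)//|/unbalanced_componentP[C2 [y2 [u2 C2F y2C vy2]]]] :=
  boolP (balanced_component S F [set w | conn F v w]).
have FeF : F \subset e |: F by rewrite subsetUr.
have bar : (exists2 D : {set E}, D \subset e |: F & is_barbell S D) ->
    exists2 D : {set E}, D \subset e |: F & is_circuit S D.
  by case=> D DF bD; exists D => //; right.
(* With the ends in different components of [F], the cycles found at the two ends are disjoint and
   [e] links them. *)
have [vu|nvu] := boolP (conn F v u); last first.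
  have disj z : z \in vertices C1 -> z \in vertices C2 -> False.
    move=> z1 z2; case/negP: nvu; apply: connect_trans vy2 _.
    apply: connect_trans (cycle_conn u2.1 C2F y2C z2) _.
    by apply: connect_trans (cycle_conn u1.1 C1F z1 y1C) _; rewrite connC.
  apply/bar/(barbell_exists u1 u2 _ (subset_trans C1F FeF) (subset_trans C2F FeF) _ y1C y2C).
  - by apply/eqP => e12; apply: (disj y1); rewrite // -e12.
  - by move=> z z' /setIP[z1 /(disj _ z1)].
  apply: connect_trans (conn_sub FeF vy2); rewrite connC in uy1.
  apply: connect_trans (conn_sub FeF uy1) _; apply: conn_edge j; exact: setU11.
have [q pq qF] := conn_path vu.
have [eqn|neqn] := eqVneq (walk_neg S q) (neg S e).
  exact: balanced_cycle_path eF j pq qF eqn.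
have [[z [z' [zC [z'C [zq [z'q nz]]]]]]|one] := pselect (exists z z',
  z \in vertices C1 /\ z' \in vertices C1 /\ z \in v :: unzip2 q /\
  z' \in v :: unzip2 q /\ z != z').
  have [q' pq' [qF' nq']] := reroute (neg S e) pq qF u1 C1F zC z'C zq z'q nz.
  exact: balanced_cycle_path eF j pq' qF' nq'.
have nein : e \notin unzip1 q by apply: contra eF => /qF.
(* The cycle formed by [e] and [q] is now unbalanced and shares at most one vertex with [C1], so
   these two yield a barbell. *)
set C := e |: [set f in unzip1 q].
have CF : C \subset e |: F by apply: setUS; apply/subsetP=> f; rewrite inE => /qF.
have uC : unbalanced_cycle S C.
  split; first exact: cycle_of_path j pq nein.
  have dC : cycle_decomposition S C e u v q by split.
  by rewrite (odd_neg_cycle dC); move: neqn; case: walk_neg; case: neg.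
have VC : vertices C = [set w in v :: unzip2 q] := vertices_path j pq.
apply/bar/(barbell_exists u1 uC _ (subset_trans C1F FeF) CF _ y1C (y := v)).
- apply: contraNneq eF => e1; apply: (subsetP C1F); rewrite e1; exact: setU11.
- move=> z z' /setIP[z1]; rewrite VC inE => zq /setIP[z'1]; rewrite inE => z'q.
  by apply/eqP/negP => /negP nz; apply: one; exists z, z'.
- by rewrite VC inE mem_head.
apply: conn_sub FeF _; rewrite connC; apply: connect_trans vu uy1.
Qed.

Lemma signsN (b : bool) a : ((-1) ^+ b * a \in signs) = (a \in signs).
Proof.
case: b; rewrite ?mul1r // expr1 mulN1r !inE !eqr_oppLR opprK oppr0.
by do 3!case: (a == _).
Qed.

(** Here [gamma] is 1 and every [beta] is 3, since each switched list is again [signs]. *)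
Lemma num_agreeing_signs F :
  num_agreeing S (fun _ => signs) F = (3 ^ #|balanced_components S F|)%N.
Proof.
rewrite num_agreeingE => [|v]; last by apply/fset0Pn; exists 0; exact: signs0.
have -> : gamma S (fun _ => signs) F = 1%N.
  rewrite /gamma ifF //; apply/negbTE; rewrite negb_exists; apply/forallP=> T.
  rewrite !negb_and negbK; apply/orP; right; apply/orP; right.
  by rewrite negb_exists; apply/forallP=> v; rewrite signs0 andbF.
rewrite mul1n -prod_nat_const; apply: eq_bigr => T TB; rewrite /beta.
case: pickP => [X _|no]; last by have [X] := switching_exists TB; rewrite no.
have /imsetP[v _ defT] : T \in components S F by move: TB; rewrite inE => /andP[].
have vT : v \in T by rewrite defT inE connect0.
rewrite (_ : [fset a in _ | _]%fset = signs).
  by rewrite /signs -fsetUA !cardfsU1 cardfs1 !inE.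
apply/fsetP=> a; rewrite !inE /=; apply/andP/idP => [[_ /forall_inP/(_ v vT)]|aS].
  by rewrite mem_switched_list signsN !inE.
have aX w : a \in switched_list (fun _ => signs) X w.
  by rewrite mem_switched_list signsN !inE.
split; last by apply/forall_inP.
by apply/bigfcupP; exists v; rewrite ?vT ?aX // mem_index_enum.
Qed.

(** * Linear algebra over the field with three elements *)

Definition F3_solutions F : {set {ffun V -> 'F_3}} :=
  [set c : {ffun V -> 'F_3} |
    [forall e in F, c (ends S e).1 == (-1) ^+ neg S e * c (ends S e).2]].

Lemma signs_F3_inj : {in signs &, injective (fun a : int => a%:~R : 'F_3)}.
Proof.
move=> a b; rewrite !inE => /orP[/orP[]|] /eqP-> /orP[/orP[]|] /eqP-> //.
Qed.

Lemma signs_F3_onto (t : 'F_3) : exists a : signs, (val a)%:~R = t.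
Proof.
have aux a (aS : a \in signs) : a%:~R = t -> exists a : signs, (val a)%:~R = t.
  by exists [` aS]%fset.
case: t aux => -[|[|[|//]]] lt aux.
- by apply: (aux 0); rewrite ?inE //; apply: val_inj.
- by apply: (aux 1); rewrite ?inE //; apply: val_inj.
- by apply: (aux (-1)); rewrite ?inE //; apply: val_inj.
Qed.

(** Reduction modulo 3 is a bijection from [signs] to the field and commutes with sign changes, so
    it matches the colorings violating [F] with the solutions. *)
Lemma card_F3_solutions F : #|F3_solutions F| = (3 ^ #|balanced_components S F|)%N.
Proof.
rewrite -num_agreeing_signs /num_agreeing.
pose red (c : {dffun forall v : V, signs}) : {ffun V -> 'F_3} := [ffun v => (val (c v))%:~R].
have red_inj : injective red.
  move=> c d /ffunP eqcd; apply/ffunP=> v; apply: val_inj.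
  apply: signs_F3_inj; [exact: valP | exact: valP |].
  by have := eqcd v; rewrite !ffunE.
have redP c : (red c \in F3_solutions F) = (F \subset agreeing S c).
  rewrite inE; apply/forall_inP/subsetP => H e eF.
    have := H e eF; rewrite !ffunE inE /agrees /sign => /eqP eq3; apply/eqP.
    apply: signs_F3_inj; [exact: valP | rewrite signsN; exact: valP |].
    by rewrite /= rmorphM rmorph_sign.
  have := H e eF; rewrite !ffunE inE /agrees /sign => /eqP->.
  by rewrite rmorphM rmorph_sign.
rewrite -(card_imset _ red_inj); apply: eq_card => d; apply/idP/imsetP.
  have [a aE] := choice (fun v => signs_F3_onto (d v)).
  have def_d : d = red [ffun v => a v] by apply/ffunP=> v; rewrite !ffunE aE.
  by rewrite def_d => dF; exists [ffun v => a v]; rewrite // inE -redP.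
by case=> c; rewrite inE -redP => cF ->.
Qed.

(** Split the solutions for [F] by the defect [phi] at [e], which has three possible values.
    Subtracting a fixed member of a class maps the class injectively into the solutions that satisfy
    the equation of [e] as well. *)
Lemma F3_solutionsU1 F e : (#|F3_solutions F| <= 3 * #|F3_solutions (e |: F)|)%N.
Proof.
pose phi (c : {ffun V -> 'F_3}) := c (ends S e).1 - (-1) ^+ neg S e * c (ends S e).2.
rewrite -sum1_card (partition_big phi predT) //=.
rewrite -[X in (_ <= X * _)%N](card_Fp (isT : prime 3)) -sum_nat_const.
apply: leq_sum => t _.
pose K := [set c in F3_solutions F | phi c == t].
have -> : (\sum_(c in F3_solutions F | phi c == t) 1 = #|K|)%N.
  by rewrite -sum1_card; apply: eq_bigl => c; rewrite [RHS]inE.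
have [->|[c0 Kc0]] := set_0Vmem K; first by rewrite cards0.
rewrite -(card_imset (mem K) (@addIr _ (- c0))); apply: subset_leq_card.
apply/subsetP=> d /imsetP[c Kc ->]; move: Kc Kc0.
rewrite !inE => /andP[/forall_inP cF /eqP ct] /andP[/forall_inP c0F /eqP c0t].
apply/forall_inP=> f; rewrite !inE !ffunE mulrBr => /predU1P[->|fF]; last first.
  by rewrite (eqP (cF f fF)) (eqP (c0F f fF)).
have phiE (h : {ffun V -> 'F_3}) :
    h (ends S e).1 = phi h + (-1) ^+ neg S e * h (ends S e).2 by rewrite subrK.
by rewrite (phiE c) (phiE c0) ct c0t opprD addrACA subrr add0r.
Qed.

(** By induction it suffices that removing an edge [e] raises the number of balanced components by
    exactly one. The rise is at most one because the number of solutions grows at most threefold; it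
    is at least one because otherwise [e] would follow from [G], and [F] would contain a circuit. *)
Lemma circuit_free_rank F :
  (forall C : {set E}, is_circuit S C -> ~~ (C \subset F)) ->
  (#|balanced_components S F| + #|F|)%N = #|V|.
Proof.
have inj3 : injective (expn 3) by move=> a b /eqP; rewrite eqn_exp2l // => /eqP.
have [n] := ubnP #|F|; elim: n F => // n IHn F; rewrite ltnS => szF free.
have [->|[e eF]] := set_0Vmem F.
  (* Without equations all maps are solutions, [3 ^ #|V|] in number. *)
  rewrite cards0 addn0; apply: inj3; rewrite -card_F3_solutions.
  rewrite -[X in (X ^ _)%N](card_Fp (isT : prime 3)) -card_ffun; apply: eq_card => c.
  by rewrite !inE; apply/forall_inP=> e; rewrite inE.
pose G := F :\ e; have defF : F = e |: G by rewrite setD1K.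
have eG : e \notin G by rewrite setD11.
have cardF : #|F| = #|G|.+1 by rewrite (cardsD1 e F) eF.
have Gfree C : is_circuit S C -> ~~ (C \subset G).
  by move=> /free; apply: contra => /subset_trans; apply; rewrite subsetDl.
have GF : G \subset F by rewrite subsetDl.
rewrite -(IHn G) //; last by rewrite -cardF.
rewrite cardF addnS -addSn; congr (_ + _)%N; apply/eqP.
rewrite eqn_leq; apply/andP; split; last first.
  rewrite -(leq_exp2l _ _ (isT : 1 < 3)%N) expnS -!card_F3_solutions defF.
  exact: F3_solutionsU1.
rewrite -(ltn_exp2l _ _ (isT : 1 < 3)%N) -!num_agreeing_signs.
apply: proper_card; apply/properP; split.
  by apply/subsetP=> c; rewrite !inE; apply: subset_trans.
have [//|no] := pselect (exists2 c, c \in [set c | G \subset agreeing S c]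
                  & c \notin [set c : {dffun forall v : V, signs} | F \subset agreeing S c]).
have [||D DF cD] := @closed_edge_circuit G e; [exact: eG| |]; last first.
  by have := free D cD; rewrite defF DF.
move=> c cS agG; apply/negPn/negP => nag; apply: no.
pose d : {dffun forall v : V, signs} := [ffun v => [` cS v]%fset].
have dE f : (f \in agreeing S d) = agrees S c f by rewrite inE /agrees !ffunE.
exists d; rewrite inE; first by apply/subsetP=> f /agG; rewrite dE.
by apply: contra nag => /subsetP/(_ e eF); rewrite dE.
Qed.

End Rank.

(** * The three formulas *)

Section Gamma.
Variables (V E : finType) (S : signed_graph V E) (L : V -> {fset int}).

Lemma balanced_componentW (F : {set E}) (T : {set V}) :
  balanced S F -> balanced_component S F T.
Proof.
move=> /asboolP bal; apply/asboolP => -[C CT uC]; apply: bal; exists C => //.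
exact: subset_trans CT (component_edgesS S F T).
Qed.

Lemma gamma_zero_included (F : {set E}) : zero_included L -> gamma S L F = 1%N.
Proof.
move=> L0; rewrite /gamma ifF //; apply/negbTE/exists_inPn => T _.
by rewrite negb_and orbC; apply/orP; left; apply/exists_inPn => v _; rewrite L0.
Qed.

(** An unbalanced cycle lies within the component of any of its vertices, and no list there contains
    0. *)
Lemma gamma_zero_free (F : {set E}) : zero_free L -> gamma S L F = balanced S F.
Proof.
move=> L0; rewrite /gamma; have [bal|unb] := boolP (balanced S F).
  by rewrite ifF //; apply/negbTE/exists_inPn => T _; rewrite balanced_componentW.
rewrite ifT //; have /asboolP/contrapT[C CF uC] := unb.
have /set0Pn[e eC] := cycle_neq0 uC.1.
have /andP[yC _] := ends_mem S eC; set y := (ends S e).1 in yC.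
apply/exists_inP; exists [set w | connect (adjacent S F) y w]; first exact: component_in.
apply/andP; split; last by apply/exists_inP; exists y; rewrite ?inE ?connect0.
apply/asboolP; rewrite notK; exists C => //; apply/subsetP=> f fC.
have /andP[a b] := ends_mem S fC.
by rewrite !inE (subsetP CF f fC) (cycle_conn uC.1 CF yC a) (cycle_conn uC.1 CF yC b).
Qed.

End Gamma.

(** The top cardinality is split off because, in the application, sets of size [n] have no balanced
    component and hence no [beta] factor. *)
Lemma sum_nbc_card (V E : finType) (S : signed_graph V E) (le : rel E) (n : nat)
    (w : {set E} -> int) :
  (forall F, F \in nbc S le -> (#|F| <= n)%N) ->
  \sum_(F in nbc S le) (-1) ^+ #|F| * w F =
  \sum_(i < n) (-1) ^+ i * (\sum_(F in nbc_card S le i) w F)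
  + \sum_(F in nbc_card S le n) (-1) ^+ n * w F.
Proof.
(* [inord] keeps the cardinality because it is at most [n]; beyond that it would return 0. *)
move=> le_n; rewrite (partition_big (fun F : {set E} => inord #|F| : 'I_n.+1) predT) //=.
rewrite big_ord_recr /=; congr (_ + _); first apply: eq_bigr => i _; rewrite ?mulr_sumr;
  apply: eq_big => F.
- rewrite !inE; apply: andb_id2l => nF; rewrite -val_eqE /= inordK // ltnS.
  by apply: le_n; rewrite inE.
- by rewrite -val_eqE /= => /andP[nF]; rewrite inordK ?ltnS ?le_n // => /eqP->.
- rewrite !inE; apply: andb_id2l => nF; rewrite -val_eqE /= inordK // ltnS.
  by apply: le_n; rewrite inE.
- by rewrite -val_eqE /= => /andP[nF]; rewrite inordK ?ltnS ?le_n // => /eqP->.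
Qed.

Theorem theorem2p5 (V E : finType) (S : signed_graph V E) (n : nat)
    (hn : #|V| = n) (le : rel E) (le_total : total le)
    (le_anti : antisymmetric le) (le_trans : transitive le)
    (L : V -> {fset int}) (hL : forall v : V, L v != fset0) :
  [/\ (forall (i : nat) (F : {set E}), (i <= n)%N -> F \in nbc_card S le i ->
         #|balanced_components S F| = (n - i)%N),
      ((num_colorings S L)%:Z =
         \sum_(i < n) (-1) ^+ i *
           (\sum_(F in nbc_card S le i)
              (gamma S L F)%:Z *
              \prod_(T in balanced_components S F) (beta S L F T)%:Z)
         + \sum_(F in nbc_card S le n) (-1) ^+ n * (gamma S L F)%:Z),
      (zero_included L ->
         (num_colorings S L)%:Z =
         \sum_(i < n) (-1) ^+ i *
           (\sum_(F in nbc_card S le i)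
              \prod_(T in balanced_components S F) (beta S L F T)%:Z)
         + \sum_(F in nbc_card S le n) (-1) ^+ n)
    & ((0 < n)%N -> zero_free L ->
         (num_colorings S L)%:Z =
         \sum_(i < n) (-1) ^+ i *
           (\sum_(F in nbc_card_bal S le i)
              \prod_(T in balanced_components S F) (beta S L F T)%:Z))].
Proof.
have rank F : F \in nbc S le -> (#|balanced_components S F| + #|F|)%N = n.
  move=> nF; rewrite -hn; apply: circuit_free_rank => C.
  exact: nbc_circuit_free.
have nbcW i F : F \in nbc_card S le i -> F \in nbc S le /\ #|F| = i.
  by rewrite inE => /andP[nF /eqP].
have formula : (num_colorings S L)%:Z =
         \sum_(i < n) (-1) ^+ i *
           (\sum_(F in nbc_card S le i)
              (gamma S L F)%:Z *
              \prod_(T in balanced_components S F) (beta S L F T)%:Z)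
         + \sum_(F in nbc_card S le n) (-1) ^+ n * (gamma S L F)%:Z.
  rewrite (num_colorings_nbc S L le_total le_anti le_trans).
  under eq_bigr => F _ do rewrite num_agreeingE // PoszM (big_morph Posz PoszM (erefl 1%:Z)).
  rewrite (@sum_nbc_card _ _ S le n); last by move=> F /rank <-; rewrite leq_addl.
  congr (_ + _); apply: eq_bigr => F /nbcW[/rank nF Fn].
  (* For [#|F| = n] the rank identity leaves no balanced component, so the product is empty. *)
  rewrite big_pred0 ?mulr1 // => T; apply: contraPF nF => TB.
  rewrite Fn => /eqP; rewrite -{2}[n]add0n eqn_add2r cards_eq0 => /eqP B0.
  by rewrite B0 inE in TB.
split=> //.
- by move=> i F _ /nbcW[/rank <- ->]; rewrite addnK.
- move=> L0; rewrite formula; congr (_ + _); last first.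
    by apply: eq_bigr => F _; rewrite gamma_zero_included // mulr1.
  apply: eq_bigr => i _; congr (_ * _); apply: eq_bigr => F _.
  by rewrite gamma_zero_included // mul1r.
move=> n_gt0 L0; rewrite formula [X in _ + X]big1 ?addr0 => [|F /nbcW[/rank nF Fn]].
  (* For 0-free lists [gamma] is the indicator of balance, which restricts the sum to balanced
     [F]. *)
  apply: eq_bigr => i _; congr (_ * _); rewrite [RHS]big_mkcond [LHS]big_mkcond /=.
  apply: eq_bigr => F _; rewrite gamma_zero_free // [in RHS]inE.
  by case: (F \in _) => //=; case: balanced; rewrite ?mul1r ?mul0r.
(* In a balanced [F] the component of any vertex would be balanced, against the rank identity. A
   vertex exists because [n] is positive; for [n = 0] the empty set would contribute 1 here. *)
rewrite gamma_zero_free // (_ : balanced S F = false) ?mulr0 //; apply/negbTE/negP => bal.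
have /card_gt0P[v _] : (0 < #|V|)%N by rewrite hn.
have : (0 < #|balanced_components S F|)%N.
  apply/card_gt0P; exists [set w | connect (adjacent S F) v w].
  by rewrite inE component_in balanced_componentW.
by move: nF; rewrite Fn => /eqP; rewrite -{2}[n]add0n eqn_add2r => /eqP->.
Qed.
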